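(* Let $\mu>0$, $\rho_\pm>0$ and $u_\pm\in\mathbb{R}$ be fixed with $u_->u_+$. For $k_1,k_2>0$ such that $(\rho_+,u_+)\in IV(\rho_-,u_-)$, let $(\rho,u)=(\rho^{k_1,k_2},u^{k_1,k_2})$ be the two-shock ($S_1+S_2$) Riemann solution of $$\begin{cases}\rho_t+(\rho u)_x=0,\\ (\rho u)_t+\left(-\dfrac{k_1}{\rho}+\rho u^2+\dfrac{k_2^2\rho^2}{2\mu}\right)_x=0,\end{cases}\qquad (\rho,u)(x,0)=(\rho_\pm,u_\pm)\ \text{ for }\ \pm x>0 .$$ Then, as $k_1,k_2\to0$, $(\rho,u)$ converges in the sense of distributions, and the limits of $\rho$ and $\rho u$ are each the sum of a step function (equal to $\rho_-$, respectively $\rho_-u_-$, for $x<\sigma t$ and to $\rho_+$, respectively $\rho_+u_+$, for $x>\sigma t$) and a $\delta$-measure supported on the ray $x=\sigma t$, $t\ge 0$, with weights $$(\sigma[\rho]-[\rho u])\,t\qquad\text{and}\qquad(\sigma[\rho u]-[\rho u^2])\,t,$$ respectively. These limits form a delta shock wave solution of the transport equations $$\rho_t+(\rho u)_x=0,\qquad(\rho u)_t+(\rho u^2)_x=0$$ with the same Riemann initial data $(\rho_\pm,u_\pm)$.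
   Context: Notation: $[q]=q_+-q_-$ (so $[\rho]=\rho_+-\rho_-$, $[\rho u]=\rho_+u_+-\rho_-u_-$, $[\rho u^2]=\rho_+u_+^2-\rho_-u_-^2$) and $$\sigma=\frac{\sqrt{\rho_-}\,u_-+\sqrt{\rho_+}\,u_+}{\sqrt{\rho_-}+\sqrt{\rho_+}}.$$ Put $g(\rho,\rho')=\sqrt{\frac{1}{\rho\rho'}\left(\frac{k_1}{\rho\rho'}+\frac{k_2^2(\rho+\rho')}{2\mu}\right)}$. The region $IV(\rho_-,u_-)$ (depending on $k_1,k_2$) is the set of $(\rho,u)$ with $\rho>0$ lying on the small-$u$ side of the shock curves $S_1$ and $S_2$ through $(\rho_-,u_-)$, i.e. $u<u_--g(\rho,\rho_-)\,|\rho-\rho_-|$. For $(\rho_+,u_+)\in IV(\rho_-,u_-)$ the Riemann solution is, with $\xi=x/t$, $$(\rho,u)(\xi)=\begin{cases}(\rho_-,u_-),&\xi<\sigma_1,\\(\rho_*,u_* ),&\sigma_1<\xi<\sigma_2,\\(\rho_+,u_+),&\xi>\sigma_2,\end{cases}$$ where $\rho_*>\max(\rho_-,\rho_+)$ and $u_*$ are determined by $u_*=u_--g(\rho_*,\rho_-)(\rho_*-\rho_-)$ and $u_+=u_*+g(\rho_+,\rho_* )(\rho_+-\rho_* )$, and $\sigma_1=u_--\rho_*g(\rho_*,\rho_-)$, $\sigma_2=u_*+\rho_+g(\rho_+,\rho_* )$ are the speeds of the 1-shock $S_1$ and the 2-shock $S_2$. The limit $k_1,k_2\to0$ is the limit $(k_1,k_2)\to(0,0)$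 through positive values, with $\mu,\rho_\pm,u_\pm$ fixed. A $\delta$-measure with weight $w(t)$ on the ray $S=\{(x,t):x=\sigma t,\ t\ge0\}$ is the distribution $\langle w\,\delta_S,\phi\rangle=\int_0^{\infty}w(t)\,\phi(\sigma t,t)\,dt$ for $\phi\in C_0^\infty(\mathbb{R}\times[0,\infty))$. A delta shock wave solution of the transport equations with data $(\rho_\pm,u_\pm)$ is one of the form $(\rho,u)=(\rho_-,u_-)$ for $x<\sigma t$, $(w(t)\delta(x-\sigma t),\sigma)$ on $x=\sigma t$, $(\rho_+,u_+)$ for $x>\sigma t$, with $w\in C^1[0,\infty)$, $w(0)=0$, satisfying the generalized Rankine–Hugoniot conditions $\frac{dw}{dt}=\sigma[\rho]-[\rho u]$, $\frac{d(w\sigma)}{dt}=\sigma[\rho u]-[\rho u^2]$ and the entropy condition $u_+<\sigma<u_-$; here $\rho$ carries the weight $w(t)$ and $\rho u$ the weight $\sigma w(t)$ on the ray. *)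

(* Defs.v *)
From HB Require Import structures.
From mathcomp Require Import all_boot all_order all_algebra.
From mathcomp Require Import ring lra.
From mathcomp Require Import all_classical all_reals all_analysis.

Set Implicit Arguments.
Unset Strict Implicit.
Unset Printing Implicit Defensive.

Import Order.TTheory GRing.Theory Num.Theory.
Import numFieldNormedType.Exports.

Local Open Scope classical_set_scope.
Local Open Scope ring_scope.

(* Throughout, rm, um, rp, up stand for rho_-, u_-, rho_+, u_+. *)

(* [q] = q_+ - q_-; the first argument is q_-. *)
Definition jump (R : realType) (qm qp : R) : R := qp - qm.

Definition delta_speed (R : realType) (rm um rp up : R) : R :=
  (Num.sqrt rm * um + Num.sqrt rp * up) / (Num.sqrt rm + Num.sqrt rp).

Section Riemann.
Context {R : realType}.
Implicit Types mu k r v rs us xi : R.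

(* The system is  r_t + (r v)_x = 0,  (r v)_t + (momentum_flux r v)_x = 0. *)
Definition momentum_flux mu k1 k2 r v : R :=
  - (k1 / r) + r * v ^+ 2 + k2 ^+ 2 * r ^+ 2 / (2 * mu).

Definition shock_g mu k1 k2 r (r' : R) : R :=
  Num.sqrt ((r * r')^-1 *
            (k1 / (r * r') + k2 ^+ 2 * (r + r') / (2 * mu))).

Definition region_IV mu k1 k2 (rm um : R) : set (R * R) :=
  [set p | 0 < p.1 /\ p.2 < um - shock_g mu k1 k2 p.1 rm * `|p.1 - rm|].

Definition intermediate_state mu k1 k2 (rm um rp up rs us : R) : Prop :=
  [/\ Num.max rm rp < rs,
      us = um - shock_g mu k1 k2 rs rm * (rs - rm) &
      up = us + shock_g mu k1 k2 rp rs * (rp - rs)].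

Definition shock_speed1 mu k1 k2 (rm um rs : R) : R :=
  um - rs * shock_g mu k1 k2 rs rm.

Definition shock_speed2 mu k1 k2 (rp rs us : R) : R :=
  us + rp * shock_g mu k1 k2 rp rs.

(* rho and u are functions of xi = x / t; their values on the two shocks are
   left unspecified. *)
Definition two_shock_solution mu k1 k2 (rm um rp up : R) (rho u : R -> R) :
    Prop :=
  exists rs us, intermediate_state mu k1 k2 rm um rp up rs us /\
    let s1 := shock_speed1 mu k1 k2 rm um rs in
    let s2 := shock_speed2 mu k1 k2 rp rs us in
    forall xi,
      [/\ xi < s1 -> rho xi = rm /\ u xi = um,
          s1 < xi < s2 -> rho xi = rs /\ u xi = us &
          s2 < xi -> rho xi = rp /\ u xi = up].

(* Both discontinuities satisfy the Rankine-Hugoniot conditions of the system,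
   so the function above is a weak solution of it. *)
Lemma intermediate_state_RH mu k1 k2 (rm um rp up rs us : R) :
  0 < mu -> 0 < k1 -> 0 < k2 -> 0 < rm -> 0 < rp ->
  intermediate_state mu k1 k2 rm um rp up rs us ->
  let s1 := shock_speed1 mu k1 k2 rm um rs in
  let s2 := shock_speed2 mu k1 k2 rp rs us in
  let f := momentum_flux mu k1 k2 in
  [/\ s1 * jump rm rs = jump (rm * um) (rs * us),
      s1 * jump (rm * um) (rs * us) = jump (f rm um) (f rs us),
      s2 * jump rs rp = jump (rs * us) (rp * up) &
      s2 * jump (rs * us) (rp * up) = jump (f rs us) (f rp up)].
Proof.
move=> mu0 k10 k20 rm0 rp0 [rs_gt us_eq up_eq] s1 s2 f.
have rs0 : 0 < rs by rewrite (lt_trans _ rs_gt)// lt_max rm0.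
have gE r r' : 0 < r -> 0 < r' -> shock_g mu k1 k2 r r' ^+ 2 =
    (r * r')^-1 * (k1 / (r * r') + k2 ^+ 2 * (r + r') / (2 * mu)).
  move=> r0 r'0; rewrite sqr_sqrtr// mulr_ge0//.
    by rewrite invr_ge0 mulr_ge0 ?ltW.
  by rewrite addr_ge0 ?divr_ge0 ?mulr_ge0 ?addr_ge0 ?exprn_ge0 ?ltW.
have g1 := gE _ _ rs0 rm0; have g2 := gE _ _ rp0 rs0.
rewrite /s1 /s2 /f /jump /shock_speed1 /shock_speed2 /momentum_flux.
rewrite up_eq us_eq.
set a := shock_g mu k1 k2 rs rm in g1 *; set b := shock_g mu k1 k2 rp rs in g2 *.
have [rmN rpN rsN muN] : [/\ rm != 0, rp != 0, rs != 0 & mu != 0].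
  by split; rewrite gt_eqF.
pose v := um - a * (rs - rm).
split; first by ring.
- have E : - (k1 / rs) + k2 ^+ 2 * rs ^+ 2 / (2 * mu)
         - (- (k1 / rm) + k2 ^+ 2 * rm ^+ 2 / (2 * mu))
         = a ^+ 2 * (rs * rm) * (rs - rm).
    by rewrite g1; field; rewrite rmN rsN muN.
  by apply: subr0_eq; rewrite -(subrr (a ^+ 2 * (rs * rm) * (rs - rm))) -[X in _ = _ - X]E /v; ring.
- by ring.
- rewrite -/v.
  have E : - (k1 / rp) + k2 ^+ 2 * rp ^+ 2 / (2 * mu)
         - (- (k1 / rs) + k2 ^+ 2 * rs ^+ 2 / (2 * mu))
         = b ^+ 2 * (rp * rs) * (rp - rs).
    by rewrite g2; field; rewrite rpN rsN muN.
  by apply: subr0_eq; rewrite -(subrr (b ^+ 2 * (rp * rs) * (rp - rs))) -[X in _ = _ - X]E /v; ring.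
Qed.

End Riemann.

Section Distributions.
Context {R : realType}.
Implicit Types (f w : R -> R) (phi : R -> R -> R) (x t s : R).

Local Notation leb := (@lebesgue_measure R).

(* Derivative of a function on [0, +oo[, one-sided at t = 0. *)
Definition derive_half_line f t (l : R) : Prop :=
  (fun s => (f s - f t) / (s - t)) @ within `[0, +oo[ t^' --> l.

Definition C1_half_line f : Prop :=
  exists f' : R -> R,
    (forall t, 0 <= t -> derive_half_line f t (f' t)) /\
    {within `[0, +oo[, continuous f'}.

(* phi x t is smooth up to the boundary on R x [0, +oo[: D i j is the
   derivative of order i in x and j in t.  Values at t < 0 are irrelevant. *)
Definition smooth_half_plane phi : Prop :=
  exists D : nat -> nat -> R -> R -> R,
    (forall x t, 0 <= t -> D 0 0 x t = phi x t) /\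
    forall i j : nat,
      [/\ {within [set p : R * R | 0 <= p.2],
             continuous (fun p : R * R => D i j p.1 p.2)},
          forall x t, 0 <= t ->
            is_derive x 1 (fun y => D i j y t) (D i.+1 j x t) &
          forall x t, 0 <= t ->
            derive_half_line (fun s => D i j x s) t (D i j.+1 x t)].

Definition test_function phi : Prop :=
  smooth_half_plane phi /\
  exists M : R, forall x t, 0 <= t -> (M < `|x|) || (M < t) -> phi x t = 0.

(* Distributions on R x [0, +oo[, as functionals; only their values on test
   functions matter. *)
Definition distribution_fun := (R -> R -> R) -> R.

Definition regular_distr (f : R -> R -> R) : distribution_fun := fun phi =>
  \int[leb]_(t in `[0, +oo[) (\int[leb]_(x in [set: R]) (f x t * phi x t)).

Definition delta_ray (s : R) w : distribution_fun := fun phi =>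
  \int[leb]_(t in `[0, +oo[) (w t * phi (s * t) t).

Definition step_fun (s qm qp : R) : R -> R -> R := fun x t =>
  if x < s * t then qm else qp.

Definition step_plus_delta (s qm qp : R) w : distribution_fun := fun phi =>
  regular_distr (step_fun s qm qp) phi + delta_ray s w phi.

(* Convergence in the sense of distributions as (k1, k2) -> (0, 0) through
   positive values. *)
Definition distr_cvg (T : R -> R -> distribution_fun) (L : distribution_fun) :
    Prop :=
  forall phi, test_function phi ->
    (fun k : R * R => T k.1 k.2 phi)
      @ within [set k : R * R | 0 < k.1 /\ 0 < k.2] (nbhs ((0, 0) : R * R))
      --> L phi.

(* The velocity of a delta shock wave of speed s, with value s on the ray. *)
Definition delta_shock_velocity (s um up : R) : R -> R -> R := fun x t =>
  if x < s * t then um else if x == s * t then s else up.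

(* The distributions Rho, U, M, standing for rho, u and rho u, are those of a
   delta shock wave solution of  rho_t + (rho u)_x = 0,
   (rho u)_t + (rho u^2)_x = 0  propagating with speed s. *)
Definition delta_shock_wave_solution (rm um rp up s : R)
    (Rho U M : distribution_fun) : Prop :=
  exists w : R -> R,
    [/\ C1_half_line w /\ w 0 = 0,
        forall t, 0 <= t ->
          derive_half_line w t (s * jump rm rp - jump (rm * um) (rp * up)) /\
          derive_half_line (fun t' => w t' * s) t
            (s * jump (rm * um) (rp * up)
             - jump (rm * um ^+ 2) (rp * up ^+ 2)),
        up < s < um &
        forall phi, test_function phi ->
          [/\ Rho phi = step_plus_delta s rm rp w phi,
              U phi = regular_distr (delta_shock_velocity s um up) phi &
              M phi = step_plus_delta s (rm * um) (rp * up)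
                        (fun t => s * w t) phi]].

End Distributions.

(* Main.v *)
Require Import Defs.
From HB Require Import structures.
From mathcomp Require Import all_boot all_order all_algebra.
From mathcomp Require Import ring lra.
From mathcomp Require Import all_classical all_reals all_analysis.
From mathcomp Require Import measurable_realfun.

(** Testing a self-similar fan (qm | qs | qp) with shock speeds s1 <= s2 against
    phi only involves the masses h(a) of phi over the sectors x < a t:
    the pairing is qm h(s1) + qs (h(s2) - h(s1)) + qp (h(oo) - h(s2)).
    For Lipschitz phi, h(b) - h(a) is (b - a) times the integral of
    t phi(s t, t) up to O((b - a)(|a - s| + |b - s|)), so only the limit of
    qs (s2 - s1) matters once s1, s2 -> s.

    With A = u_- - u_* and B = u_* - u_+, the fixed drop A + B > 0 has to be
    absorbed by vanishing k1, k2, which forces rho_* -> oo while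
    k2^2 rho_*^2 / (2 mu) stays bounded.  Hence rho_- A^2 - rho_+ B^2 -> 0, which
    determines A and gives u_*, sigma_1, sigma_2 -> sigma; conservation of mass
    across the two shocks gives the limit of rho_* (sigma_2 - sigma_1). *)

Set Implicit Arguments.
Unset Strict Implicit.
Unset Printing Implicit Defensive.

Import Order.TTheory GRing.Theory Num.Theory.
Import numFieldNormedType.Exports.

Local Open Scope classical_set_scope.
Local Open Scope ring_scope.

(** * Test functions are Lipschitz *)

(** At an interior time the constraint [0 <= s] holds near [t], so the one-sided limit is two-sided.
    Carathéodory's criterion then applies to the difference quotient, completed by [l] at [t]. *)
Lemma derive_half_line_is_derive (R : realType) (f : R -> R) (t l : R) :
  0 < t -> derive_half_line f t l -> is_derive t 1 f l.
Proof.
move=> t0 ft; apply/is_derive1_caratheodory.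
exists (fun s => if s == t then l else (f s - f t) / (s - t)).
split; last by rewrite eqxx.
- move=> s; case: eqVneq => [->|st]; first by rewrite !subrr mulr0.
  by rewrite divfK// subr_eq0.
- apply/continuous_withinNx; rewrite eqxx.
  apply/cvgrPdist_lt => e e0.
  move/cvgrPdist_lt : ft => /(_ e e0) ft.
  have ft' : \forall s \near t^', 0 <= s -> `|l - (f s - f t) / (s - t)| < e.
    move: ft; rewrite near_withinE => ft.
    by near=> s; move=> s0; apply: (near ft s) => //=; rewrite in_itv/= s0.
  near=> s.
  have st : s != t by near: s; exact: nbhs_dnbhs_neq.
  rewrite (negbTE st).
  apply: (near ft') => //.
  near: s; apply: nbhs_dnbhs; near=> s; apply: ltW.
  by near: s; exact: lt_nbhsr.
Unshelve. all: by end_near. Qed.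

(** All later estimates use a test function only through these properties. *)
Definition lipschitz_supported (R : realType) (phi : R -> R -> R) (L M : R) :=
  [/\ 0 <= L, 0 <= M,
      forall x y t s, 0 <= t -> 0 <= s ->
        `|phi x t - phi y s| <= L * (`|x - y| + `|t - s|) &
      forall x t, 0 <= t -> (M < `|x|) || (M < t) -> phi x t = 0].

Definition clamp (R : realType) (M x : R) := Num.max (- M) (Num.min M x).

Section Clamp.
Context {R : realType}.
Implicit Types M x y : R.

Lemma clamp_itv M x : 0 <= M -> clamp M x \in `[- M, M].
Proof.
move=> M0; rewrite in_itv/= /clamp le_max lexx/= ge_max ge_min lexx/= andbT.
by lra.
Qed.

Lemma clamp_ge0 M x : 0 <= M -> 0 <= x -> 0 <= clamp M x.
Proof. by move=> M0 x0; rewrite /clamp le_max le_min M0 x0 orbT. Qed.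

Lemma clamp_id M x : `|x| <= M -> clamp M x = x.
Proof.
move=> xM; rewrite /clamp; move: xM; rewrite ler_norml => /andP[x1 x2].
by rewrite min_r// max_r.
Qed.

Lemma norm_clamp M x : 0 <= M -> M < `|x| -> `|clamp M x| = M.
Proof.
move=> M0; rewrite ltr_normr => xM; rewrite /clamp.
have [Mx|xM'] := leP M x.
  by rewrite max_r ?ger0_norm//; lra.
rewrite max_l; last by case/orP: xM; lra.
by rewrite normrN ger0_norm.
Qed.

Lemma clamp_lipschitz M x y : 0 <= M -> `|clamp M x - clamp M y| <= `|x - y|.
Proof.
move=> M0; rewrite /clamp.
wlog xy : x y / x <= y => [H|].
  by have [/H//|/ltW/H] := leP x y; rewrite distrC (distrC x).
rewrite [`|x - y|]ler0_norm ?ler_norml; last by rewrite subr_le0.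
by rewrite !minEle; do ?[case: ifPn; rewrite -?ltNge => ?];
  rewrite !maxEle; do ?[case: ifPn; rewrite -?ltNge => ?];
  apply/andP; split; lra.
Qed.

End Clamp.

Section TestFunctionLipschitz.
Context {R : realType}.
Implicit Types phi D : R -> R -> R.

Let half_plane := [set p : R * R | 0 <= p.2].

Lemma bounded_on_box D (N : R) : 0 <= N ->
  {within half_plane, continuous (fun p : R * R => D p.1 p.2)} ->
  exists2 L : R, 0 <= L &
    forall x t : R, x \in `[- N, N] -> t \in `[0, N] -> `|D x t| <= L.
Proof.
move=> N0 /subspace_continuousP cD.
pose K := `[- N, N]%classic `*` `[0, N]%classic : set (R * R).
have cK : compact K by apply: compact_setX; exact: segment_compact.
have [||p pK Hp] := @compact_EVT_max _ R (fun p : R * R => `|D p.1 p.2|) K _ cK.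
- by exists (0, 0); split; rewrite /= in_itv/= ?oppr_le0 ?lexx ?N0.
- apply: (@continuous_subspaceW _ _ _ half_plane).
    by move=> [x t] [_ /=]; rewrite in_itv/= => /andP[].
  by apply/subspace_continuousP => q /cD cq; exact: cvg_norm.
exists `|D p.1 p.2| => // x t xN tN.
by apply: (Hp (x, t)); rewrite inE; split.
Qed.

(** Provides the continuity up to the endpoints that the mean value theorem in [t] requires,
    including at [t = 0], where only one-sided information is available. *)
Lemma within_half_plane_slice D (x a b : R) : 0 <= a ->
  {within half_plane, continuous (fun p : R * R => D p.1 p.2)} ->
  {within `[a, b], continuous (D x)}.
Proof.
move=> a0 /subspace_continuousP cD; apply/subspace_continuousP => t tab.
have t0 : 0 <= t by move: tab; rewrite /= in_itv/= => /andP[/(le_trans a0)].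
apply/cvgrPdist_lt => e e0; rewrite near_withinE.
have /cvgrPdist_lt/(_ e e0) := cD (x, t) t0; rewrite near_withinE => H.
have /nbhs_ballP[d /= d0 dH] := H.
have : \forall s \near t, 0 <= s -> `|D x t - D x s| < e.
  by near=> s; apply: (dH (x, s)); split => /=; [exact: ballxx|near: s; exact: nbhsx_ballx].
apply: filterS => s Hs; rewrite /= in_itv/= => /andP[as_ _].
exact/Hs/(le_trans a0).
Unshelve. all: by end_near. Qed.

(** The mean value theorem in each variable, with the first derivatives bounded by compactness on a
    box slightly larger than the support. *)
Lemma test_function_lipschitz phi : test_function phi ->
  exists L M : R, lipschitz_supported phi L M.
Proof.
move=> [[D [D0 sm]] [M0 suppM]].
(* The given support bound may be negative, hence the maximum with 0. The margin 1 puts the sides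
   [|x| = N] and [t = N] of the box strictly outside the support. *)
pose M : R := Num.max 0 M0; pose N : R := M + 1.
have M_ge0 : 0 <= M by rewrite le_max lexx.
have supp (x t : R) : 0 <= t -> (M < `|x|) || (M < t) -> phi x t = 0.
  move=> t0 H; apply: suppM => //; case/orP: H => H; apply/orP.
    by left; apply: le_lt_trans H; rewrite le_max lexx orbT.
  by right; apply: le_lt_trans H; rewrite le_max lexx orbT.
have N0 : 0 <= N by rewrite addr_ge0.
have MN : M < N by rewrite ltrDl.
have [c00 _ _] := sm 0%N 0%N.
have [c10 _ _] := sm 1%N 0%N.
have [c01 _ _] := sm 0%N 1%N.
have [L1 L1_ge0 HL1] := bounded_on_box N0 c10.
have [L2 L2_ge0 HL2] := bounded_on_box N0 c01.
pose L : R := Num.max L1 L2.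
have L_ge0 : 0 <= L by rewrite le_max L1_ge0.
have lipx (x y t : R) : x \in `[- N, N] -> y \in `[- N, N] -> t \in `[0, N] ->
    `|phi x t - phi y t| <= L * `|x - y|.
  wlog xy : x y / y <= x => [H xN yN tN|xN yN tN].
    have [yx|/ltW xy] := leP y x; first exact: H.
    by rewrite distrC (distrC x) H.
  have t0 : 0 <= t by rewrite (itvP tN).
  have dx (z : R) : is_derive z 1 (fun y => D 0%N 0%N y t) (D 1%N 0%N z t).
    by have [_ /(_ z t t0)] := sm 0%N 0%N.
  have [|c cyx] := @MVT_segment R (fun y => D 0%N 0%N y t) _ y x xy (fun z _ => dx z).
    apply: continuous_subspaceT => z.
    have /derivable1_diffP/differentiable_continuous := @ex_derive _ _ _ _ _ _ _ (dx z).
    by [].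
  rewrite !D0// => ->; rewrite normrM ler_wpM2r// le_max HL1//.
  by move: cyx xN yN; rewrite !in_itv/= => /andP[? ?] /andP[? ?] /andP[? ?]; apply/andP; split; lra.
have lipt (x t s : R) : x \in `[- N, N] -> t \in `[0, N] -> s \in `[0, N] ->
    `|phi x t - phi x s| <= L * `|t - s|.
  wlog st : t s / s <= t => [H xN tN sN|xN tN sN].
    have [st|/ltW ts] := leP s t; first exact: H.
    by rewrite distrC (distrC t) H.
  have s0 : 0 <= s by rewrite (itvP sN).
  have dt (z : R) : z \in `]s, t[ -> is_derive z 1 (D 0%N 0%N x) (D 0%N 1%N x z).
    rewrite in_itv/= => /andP[sz _].
    apply: derive_half_line_is_derive; first exact: le_lt_trans sz.
    have [_ _] := sm 0%N 0%N; apply; exact/(le_trans s0)/ltW.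
  have [|c cts] := MVT_segment st dt.
    exact: within_half_plane_slice.
  rewrite !D0 ?(le_trans s0)// => ->; rewrite normrM ler_wpM2r// le_max HL2 ?orbT//.
  by move: cts tN sN; rewrite !in_itv/= => /andP[? ?] /andP[? ?] /andP[? ?]; apply/andP; split; lra.
(* phi factors through the 1-Lipschitz clamping onto a box containing its
   support, so bounds on the derivatives are only needed on that box. *)
have clampE (x t : R) : 0 <= t -> phi x t = phi (clamp N x) (clamp N t).
  move=> t0.
  have [xN|xN] := leP `|x| N; last first.
    by rewrite !supp ?clamp_ge0 ?(norm_clamp _ xN) ?MN ?(lt_trans MN xN).
  have [tN|tN] := leP t N; last first.
    have cN : clamp N t = N.
      by rewrite -[LHS]ger0_norm ?clamp_ge0// norm_clamp// ger0_norm.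
    by rewrite !supp ?clamp_ge0 ?(lt_trans MN tN) ?cN ?MN ?orbT.
  by rewrite !clamp_id// ger0_norm.
have clampt (t : R) : 0 <= t -> clamp N t \in `[0, N].
  move=> t0; rewrite in_itv/= clamp_ge0//=.
  by have := clamp_itv t N0; rewrite in_itv => /andP[].
exists L, M; split => // x y t s t0 s0.
rewrite (clampE x t)// (clampE y s)//.
(* The move goes through an intermediate corner: first [x] changes, then [t]. *)
rewrite -(subrKA (phi (clamp N y) (clamp N t))) mulrDr.
apply: (le_trans (ler_normD _ _)); apply: lerD.
  apply: (le_trans (lipx _ _ _ _ _ _)); rewrite ?clamp_itv ?clampt//.
  by rewrite ler_wpM2l// clamp_lipschitz.
apply: (le_trans (lipt _ _ _ _ _ _)); rewrite ?clamp_itv ?clampt//.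
by rewrite ler_wpM2l// clamp_lipschitz.
Qed.

End TestFunctionLipschitz.

(** * Integrals of bounded functions with bounded support *)

Section SupportedIntegrals.
Context d (T : measurableType d) (R : realType).
Variable mu : {measure set T -> \bar R}.
Implicit Types (D S : set T) (f g : T -> R).

(** Since [f] vanishes off [S], its integral over [D] is one over [D] intersected with [S], a set of
    measure at most [m] on which the constant [C] is an integrable bound. *)
Lemma supported_integral D S f (C m : R) : measurable D -> measurable S ->
  measurable_fun D f -> mu S = m%:E -> 0 <= C ->
  (forall x, D x -> `|f x| <= C) -> (forall x, D x -> ~ S x -> f x = 0) ->
  mu.-integrable D (EFin \o f) /\ `|\int[mu]_(x in D) f x| <= C * m.
Proof.
move=> mD mS mf muS C0 fC f0.
have mDS : measurable (D `&` S) by exact: measurableI.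
have leDS : (mu (D `&` S) <= m%:E)%E by rewrite -muS le_measure ?inE.
have DSoo : (mu (D `&` S) < +oo)%E by rewrite (le_lt_trans leDS) ?ltry.
have fS : {in D, f =1 f \_ S}.
  move=> x /set_mem Dx; rewrite patchE; case: ifPn => // /negP xS.
  by apply: f0 => // Sx; apply: xS; rewrite inE.
have mfDS : measurable_fun (D `&` S) f by exact: measurable_funS mf.
have bC : mu.-integrable (D `&` S) (EFin \o cst C).
  by apply: measurable_bounded_integrable => //; exact: bounded_cst.
have ifDS : mu.-integrable (D `&` S) (EFin \o f).
  apply: le_integrable bC => //; first exact/measurable_EFinP.
  by move=> x [Dx _] /=; rewrite lee_fin (le_trans (fC _ Dx))// ler_norm.
split.
  apply: (eq_integrable mD (EFin \o (f \_ S))); first by move=> x xD /=; rewrite -fS.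
  by rewrite -restrict_EFin; apply/integrable_restrict.
rewrite (eq_Rintegral _ fS) -Rintegral_mkcondr.
apply: (le_trans (le_normr_Rintegral _ _)) => //.
apply: (@le_trans _ _ (\int[mu]_(x in D `&` S) C)).
  by apply: le_Rintegral => //; [exact: integrable_norm|move=> x [Dx _]; exact: fC].
rewrite Rintegral_cst// ler_wpM2l// -lee_fin fineK//.
by rewrite ge0_fin_numE// measure_ge0.
Qed.

(** [f] is [g] plus a multiple of the indicator of a null point, so the regularity of [g] passes to
    [f]. This is what absorbs the unspecified values of a fan on its shocks. *)
Lemma Rintegral_eq_off D (p : T) f g : measurable D -> measurable [set p] ->
  mu [set p] = 0%E ->
  mu.-integrable D (EFin \o g) -> (forall x, D x -> x <> p -> f x = g x) ->
  mu.-integrable D (EFin \o f) /\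
  \int[mu]_(x in D) f x = \int[mu]_(x in D) g x.
Proof.
move=> mD mp mup ig fg.
pose c x := (f p - g p) * \1_[set p] x.
have mc : measurable_fun D c by apply: measurable_funM => //; exact: measurable_cst.
have [||ic] := @supported_integral D [set p] c `|f p - g p| 0 mD mp mc mup (normr_ge0 _).
- move=> x _; rewrite /c normrM ler_piMr// indicE; case: (_ \in _) => /=.
    by rewrite normr1.
  by rewrite normr0.
- by move=> x _ xp; rewrite /c indicE memNset// mulr0.
rewrite mulr0 normr_le0 => /eqP c0.
have fE x : x \in D -> f x = g x + c x.
  move=> /set_mem Dx; rewrite /c indicE.
  have [->|xp] := pselect (x = p); first by rewrite mem_set// mulr1 subrKC.
  by rewrite memNset//= mulr0 addr0 fg.
split.
  apply: (eq_integrable mD (fun x => (g x)%:E + (c x)%:E)%E); last exact: integrableD.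
  by move=> x xD /=; rewrite fE.
by rewrite (eq_Rintegral _ fE) RintegralD// c0 addr0.
Qed.

(** Three terms, because a fan with two shocks is a combination of three indicator functions. *)
Lemma Rintegral_comb3 D f g h (a b c : R) : measurable D ->
  mu.-integrable D (EFin \o f) -> mu.-integrable D (EFin \o g) ->
  mu.-integrable D (EFin \o h) ->
  mu.-integrable D (EFin \o (fun x => a * f x + b * g x + c * h x)) /\
  \int[mu]_(x in D) (a * f x + b * g x + c * h x) =
  a * \int[mu]_(x in D) f x + b * \int[mu]_(x in D) g x + c * \int[mu]_(x in D) h x.
Proof.
move=> mD fi gi hi.
have iZ k (e : T -> R) : mu.-integrable D (EFin \o e) ->
    mu.-integrable D (EFin \o (fun x => k * e x)) by exact: integrableZl.
have ifg : mu.-integrable D (EFin \o (fun x => a * f x + b * g x)).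
  exact: (integrableD mD (iZ a _ fi) (iZ b _ gi)).
split; first exact: (integrableD mD ifg (iZ c _ hi)).
by rewrite RintegralD// ?RintegralD ?RintegralZl//; exact: iZ.
Qed.

End SupportedIntegrals.

(** * Specialisation to Lebesgue measure on the line *)

Section LebesgueLine.
Context {R : realType}.
Notation leb := (@lebesgue_measure R).
Implicit Types (D : set R) (f : R -> R).

Lemma itv_supported_integral D f (C p q : R) : measurable D ->
  measurable_fun D f -> p <= q -> 0 <= C ->
  (forall x, D x -> `|f x| <= C) ->
  (forall x, D x -> (x < p) || (q < x) -> f x = 0) ->
  leb.-integrable D (EFin \o f) /\
  `|\int[leb]_(x in D) f x| <= C * (q - p).
Proof.
move=> mD mf pq C0 fC f0.
have mpq : leb `[p, q]%classic = (q - p)%:E.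
  rewrite lebesgue_measure_itv/= lte_fin; case: ltP => // qp.
  by have -> : q = p by [apply/eqP; rewrite eq_le qp pq]; rewrite subrr.
refine (@supported_integral _ (measurableTypeR R) R leb D `[p, q]%classic
  f C (q - p) mD _ mf mpq C0 fC _) => //.
move=> x Dx xpq; apply: f0 => //; rewrite !ltNge -negb_and; apply/negP => H.
  by apply: xpq; rewrite /= in_itv.
Qed.

Lemma lipschitz_measurable D f (L : R) : measurable D -> 0 <= L ->
  (forall x y, D x -> D y -> `|f x - f y| <= L * `|x - y|) ->
  measurable_fun D f.
Proof.
move=> mD L0 lipf; apply: subspace_continuous_measurable_fun => //.
apply/subspace_continuousP => x Dx; apply/cvgrPdist_le => e e0.
(* Dividing by [L + 1] rather than [L] covers the case [L = 0]. *)
have L1 : 0 < L + 1 by rewrite ltr_wpDl.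
rewrite near_withinE; near=> y => Dy.
apply: (le_trans (lipf _ _ Dx Dy)).
apply: (@le_trans _ _ ((L + 1) * (e / (L + 1)))); last first.
  by rewrite mulrC divfK// gt_eqF.
apply: ler_pM => //; first by rewrite lerDl.
near: y; apply: cvgr_dist_le; first exact: cvg_id.
by rewrite divr_gt0.
Unshelve. all: by end_near. Qed.

Lemma cut_measurable D (y : R) : measurable_fun D (fun x : R => (x < y)%R%:R : R).
Proof.
rewrite (_ : (fun _ => _) = \1_(`]-oo, y[%classic : set R)).
  exact: measurable_indic.
by apply/funext => x; rewrite indicE mem_setE in_itv.
Qed.

Lemma eq_off_point D (p : R) f g : measurable D ->
  leb.-integrable D (EFin \o g) -> (forall x, D x -> x <> p -> f x = g x) ->
  leb.-integrable D (EFin \o f) /\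
  \int[leb]_(x in D) f x = \int[leb]_(x in D) g x.
Proof.
move=> mD ig fg.
refine (@Rintegral_eq_off _ (measurableTypeR R) R leb D p f g mD _ _ ig fg) => //.
exact: lebesgue_measure_set1.
Qed.
Lemma Rintegral_lebesgue_comb3 D f g h (a b c : R) : measurable D ->
  leb.-integrable D (EFin \o f) -> leb.-integrable D (EFin \o g) ->
  leb.-integrable D (EFin \o h) ->
  leb.-integrable D (EFin \o (fun x => a * f x + b * g x + c * h x)) /\
  \int[leb]_(x in D) (a * f x + b * g x + c * h x) =
  a * \int[leb]_(x in D) f x + b * \int[leb]_(x in D) g x +
  c * \int[leb]_(x in D) h x.
Proof.
move=> mD fi gi hi.
exact: (@Rintegral_comb3 _ (measurableTypeR R) R leb D f g h a b c mD fi gi hi).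
Qed.

End LebesgueLine.

(** * Masses over sectors *)

Definition cut (R : realType) (y x : R) : R := (x < y)%R%:R.

Definition slice_mass (R : realType) (phi : R -> R -> R) (y t : R) : R :=
  \int[@lebesgue_measure R]_(x in [set: R]) (cut y x * phi x t).

(* The offset b makes the total mass the case a = 0 with b beyond the support. *)
Definition sector_mass (R : realType) (phi : R -> R -> R) (a b : R) : R :=
  \int[@lebesgue_measure R]_(t in `[0, +oo[) slice_mass phi (a * t + b) t.

Section SectorMass.
Context {R : realType} (phi : R -> R -> R) (L M : R).
Hypothesis lip : lipschitz_supported phi L M.
Notation leb := (@lebesgue_measure R).

Let L0 : 0 <= L. Proof. by case: lip. Qed.
Let M0 : 0 <= M. Proof. by case: lip. Qed.
Let supp (x t : R) : 0 <= t -> (M < `|x|) || (M < t) -> phi x t = 0.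
Proof. by case: lip => _ _ _; apply. Qed.
Let suppx (x t : R) : 0 <= t -> (x < - M) || (M < x) -> phi x t = 0.
Proof.
move=> t0 xM; apply: supp => //; apply/orP; left; rewrite ltr_normr orbC.
by case/orP: xM => xM; apply/orP; [left|right] => //; rewrite ltrNr.
Qed.
Let lipx (x y t : R) : 0 <= t -> `|phi x t - phi y t| <= L * `|x - y|.
Proof.
by case: lip => _ _ H _ t0; rewrite (le_trans (H _ _ _ _ t0 t0))// subrr normr0 addr0.
Qed.
Let lipt (x t s : R) : 0 <= t -> 0 <= s -> `|phi x t - phi x s| <= L * `|t - s|.
Proof.
by case: lip => _ _ H _ t0 s0; rewrite (le_trans (H _ _ _ _ t0 s0))// subrr normr0 add0r.
Qed.

Let B := L * (2 * M + 1).
Let B0 : 0 <= B. Proof. by rewrite mulr_ge0// addr_ge0// mulr_ge0. Qed.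

(** [phi] vanishes at [x = M + 1], and a point of the support is at distance at most [2 * M + 1]
    from there. *)
Lemma lipschitz_supported_le (x t : R) : 0 <= t ->
  `|phi x t| <= L * (2 * M + 1).
Proof.
move=> t0; have [xM|xM] := leP `|x| M; last by rewrite supp ?xM// normr0.
rewrite -[phi x t]subr0 -(@supp (M + 1) t)//; last first.
  by rewrite ger0_norm ?ltrDl ?ltr01// addr_ge0.
rewrite (le_trans (lipx _ _ t0))// ler_wpM2l//.
by move: xM; rewrite !ler_norml => /andP[? ?]; apply/andP; split; lra.
Qed.

Lemma normr_cut_le1 (y x : R) : `|cut y x| <= 1.
Proof. by rewrite /cut; case: ltP; rewrite ?normr1 ?normr0. Qed.

Lemma slice_measurable (t : R) : 0 <= t -> measurable_fun [set: R] (phi ^~ t).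
Proof.
by move=> t0; apply: (@lipschitz_measurable _ _ _ L) => // x y _ _; exact: lipx.
Qed.

Lemma cut_slice_measurable (y t : R) : 0 <= t ->
  measurable_fun [set: R] (fun x => cut y x * phi x t).
Proof.
by move=> t0; apply: measurable_funM; [exact: cut_measurable|exact: slice_measurable].
Qed.

Lemma slice_integrable (y t : R) : 0 <= t ->
  leb.-integrable [set: R] (EFin \o (fun x => cut y x * phi x t)) /\
  `|slice_mass phi y t| <= B * (M - - M).
Proof.
move=> t0; apply: itv_supported_integral => //.
- exact: cut_slice_measurable.
- by rewrite ge0_cp.
- move=> x _; rewrite normrM -[leRHS]mul1r ler_pM ?normr_cut_le1//.
  exact: lipschitz_supported_le.
- by move=> x _ xM; rewrite suppx ?mulr0.
Qed.

Lemma slice_mass_out (y t : R) : 0 <= t -> M < t -> slice_mass phi y t = 0.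
Proof.
move=> t0 Mt; rewrite /slice_mass.
under eq_Rintegral do rewrite supp ?Mt ?orbT// mulr0.
by rewrite Rintegral_cst// mul0r.
Qed.

(** The difference of integrands splits into [cut p x * (phi x t - phi x s)], of size [L * |t - s|]
    on [[-M, M]], and [(cut p x - cut q x) * phi x s], which lives between [p] and [q], an interval
    of length [|a| * |t - s|]. The purpose is measurability in [t]. *)
Lemma slice_mass_lipschitz (a b t s : R) : 0 <= t -> 0 <= s ->
  `|slice_mass phi (a * t + b) t - slice_mass phi (a * s + b) s| <=
  (L * (M - - M) + B * `|a|) * `|t - s|.
Proof.
move=> t0 s0.
set p := a * t + b; set q := a * s + b.
have pqE : p - q = a * (t - s) by rewrite /p /q; ring.
have NM : - M <= M by rewrite ge0_cp.
have [it _] := slice_integrable p t0; have [is_ _] := slice_integrable q s0.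
have [i1 e1] : leb.-integrable [set: R] (EFin \o (fun x => cut p x * (phi x t - phi x s))) /\
  `|\int[leb]_(x in [set: R]) (cut p x * (phi x t - phi x s))| <= L * `|t - s| * (M - - M).
  apply: itv_supported_integral => //.
  - apply: measurable_funM; first exact: cut_measurable.
    by apply: measurable_funB; exact: slice_measurable.
  - by rewrite mulr_ge0.
  - move=> x _; rewrite normrM -[leRHS]mul1r ler_pM ?normr_cut_le1//.
    exact: lipt.
  - by move=> x _ xM; rewrite !suppx// subrr mulr0.
have [i2 e2] : leb.-integrable [set: R] (EFin \o (fun x => (cut p x - cut q x) * phi x s)) /\
  `|\int[leb]_(x in [set: R]) ((cut p x - cut q x) * phi x s)| <=
    B * (Num.max p q - Num.min p q).
  apply: itv_supported_integral => //.
  - apply: measurable_funM; last exact: slice_measurable.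
    by apply: measurable_funB; exact: cut_measurable.
  - by rewrite ge_min !le_max lexx.
  - move=> x _; rewrite normrM -[leRHS]mul1r ler_pM ?lipschitz_supported_le//.
    by rewrite /cut; do 2!case: ltP => ?; rewrite ?subrr ?subr0 ?sub0r ?normrN ?normr0 ?normr1.
  - move=> x _; rewrite lt_min gt_max /cut => /orP[/andP[-> ->]|/andP[px qx]].
      by rewrite subrr mul0r.
    by rewrite !ltNge (ltW px) (ltW qx)/= subrr mul0r.
rewrite /slice_mass -RintegralB//.
have -> : \int[leb]_(x in [set: R]) (cut p x * phi x t - cut q x * phi x s) =
    \int[leb]_(x in [set: R]) (cut p x * (phi x t - phi x s) + (cut p x - cut q x) * phi x s).
  by apply: eq_Rintegral => x _; ring.
rewrite RintegralD// (le_trans (ler_normD _ _))// [leRHS]mulrDl lerD//.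
  by rewrite (le_trans e1)// mulrAC.
rewrite (le_trans e2)// -[leRHS]mulrA -normrM -pqE ler_wpM2l//.
rewrite maxEle minEle; case: (leP p q) => pq.
  by rewrite distrC ler_norm.
by rewrite ler_norm.
Qed.

Lemma sector_integrable (a b : R) :
  leb.-integrable `[0, +oo[ (EFin \o (fun t => slice_mass phi (a * t + b) t)).
Proof.
have [||||||//] := @itv_supported_integral _ `[0, +oo[%classic
  (fun t => slice_mass phi (a * t + b) t) (B * (M - - M)) 0 M.
- exact: measurable_itv.
- apply: (@lipschitz_measurable _ _ _ (L * (M - - M) + B * `|a|)).
  + exact: measurable_itv.
  + by rewrite addr_ge0// mulr_ge0// opprK addr_ge0.
  + move=> t s; rewrite /= !in_itv/= !andbT => t0 s0.
    exact: slice_mass_lipschitz.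
- exact: M0.
- by rewrite mulr_ge0// opprK addr_ge0.
- by move=> t; rewrite /= in_itv/= andbT => t0; have [] := slice_integrable (a * t + b) t0.
- move=> t; rewrite /= in_itv/= andbT => t0 /orP[|Mt].
    by rewrite ltNge t0.
  exact: slice_mass_out.
Qed.

(** [cut q - cut p] is the indicator of [[p, q[], so the error is the integral of [phi x t - c] over
    that interval. *)
Lemma slice_mass_taylor (p q t c E : R) : 0 <= t -> p <= q -> 0 <= E ->
  (forall x, p <= x < q -> `|phi x t - c| <= E) ->
  `|slice_mass phi q t - slice_mass phi p t - (q - p) * c| <= E * (q - p).
Proof.
move=> t0 pq E0 phic.
have [iq _] := slice_integrable q t0; have [ip _] := slice_integrable p t0.
have mc D (y : R) : measurable_fun D (cut y) by exact: cut_measurable.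
have cut01 (x : R) : cut q x - cut p x = (p <= x < q)%R%:R.
  rewrite /cut; case: (ltP x p) => xp /=; first by rewrite (lt_le_trans xp pq) subrr.
  by rewrite subr0.
have cut0 (x : R) : (x < p) || (q < x) -> cut q x - cut p x = 0.
  by rewrite cut01; case: ltP => //= px qx; rewrite (ltNge x q) (ltW qx).
have [ic _] : leb.-integrable [set: R] (EFin \o (fun x => (cut q x - cut p x) * c)) /\ 
    `|\int[leb]_(x in [set: R]) ((cut q x - cut p x) * c)| <= `|c| * (q - p).
  apply: itv_supported_integral => //.
  - by apply: measurable_funM; [exact: measurable_funB|exact: measurable_cst].
  - move=> x _; rewrite normrM ler_piMl// cut01; case: (_ && _); rewrite ?normr1 ?normr0//.
  - by move=> x _ /cut0 ->; rewrite mul0r.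
have cE : \int[leb]_(x in [set: R]) ((cut q x - cut p x) * c) = (q - p) * c.
  transitivity (\int[leb]_(x in `[p, q[) c).
    rewrite [RHS]Rintegral_mkcond; apply: eq_Rintegral => x _.
    rewrite cut01 patchE mem_setE in_itv/=; case: ifPn => /=; by rewrite ?mul1r ?mul0r.
  have mpq : leb `[p, q[%classic = (q - p)%:E.
    rewrite lebesgue_measure_itv/= lte_fin; case: ltP => // qp.
    by have -> : q = p by [apply/eqP; rewrite eq_le qp pq]; rewrite subrr.
  by rewrite Rintegral_cst// mulrC; congr (_ * _); exact: (congr1 fine mpq).
(* With [(q - p) * c] written as an integral too, everything merges into one integrand. *)
rewrite -cE /slice_mass -RintegralB//.
have -> : \int[leb]_(x in [set: R]) (cut q x * phi x t - cut p x * phi x t) =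
    \int[leb]_(x in [set: R]) ((cut q x - cut p x) * phi x t).
  by apply: eq_Rintegral => x _; ring.
rewrite -RintegralB//; last first.
  rewrite (_ : EFin \o _ = (fun x => (cut q x * phi x t)%:E - (cut p x * phi x t)%:E)%E).
    exact: integrableB.
  by apply/funext => x /=; rewrite -EFinB mulrBl.
have -> : \int[leb]_(x in [set: R]) ((cut q x - cut p x) * phi x t - (cut q x - cut p x) * c) =
    \int[leb]_(x in [set: R]) ((cut q x - cut p x) * (phi x t - c)).
  by apply: eq_Rintegral => x _; ring.
refine (proj2 (itv_supported_integral _ _ _ _ _ _)) => //.
- apply: measurable_funM; first exact: measurable_funB.
  by apply: measurable_funB; [exact: slice_measurable|exact: measurable_cst].
- move=> x _; rewrite cut01; case: (boolP (p <= x < q)) => [H|_]; last by rewrite mul0r normr0.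
  by rewrite mul1r phic.
- by move=> x _ /cut0 ->; rewrite mul0r.
Qed.

End SectorMass.

(** * Pairing of self-similar fans with a test function *)

Section Fan.
Context {R : realType} (phi : R -> R -> R) (L M : R).
Hypothesis lip : lipschitz_supported phi L M.
Notation leb := (@lebesgue_measure R).

Let L0 : 0 <= L. Proof. by case: lip. Qed.
Let M0 : 0 <= M. Proof. by case: lip. Qed.
Let B := L * (2 * M + 1).

(** Summation by parts: off the shocks, and for [x < M + 1], [F] is [(qm - qs)] times the cut at
    [s1 * t], plus [(qs - qp)] times the cut at [s2 * t], plus [qp]. The cut at [M + 1] captures the
    whole mass of [phi]. *)
Lemma regular_distr_fan (F : R -> R -> R) (qm qs qp s1 s2 : R) : s1 <= s2 ->
  (forall x t, 0 < t ->
    [/\ x < s1 * t -> F x t = qm, s1 * t < x < s2 * t -> F x t = qs &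
        s2 * t < x -> F x t = qp]) ->
  regular_distr F phi = (qm - qs) * sector_mass phi s1 0 +
    (qs - qp) * sector_mass phi s2 0 + qp * sector_mass phi 0 (M + 1).
Proof.
move=> s12 FE.
pose G t := (qm - qs) * slice_mass phi (s1 * t + 0) t +
  (qs - qp) * slice_mass phi (s2 * t + 0) t + qp * slice_mass phi (0 * t + (M + 1)) t.
have mD : measurable (`[0, +oo[%classic : set R) by exact: measurable_itv.
have i1 := sector_integrable lip s1 0.
have i2 := sector_integrable lip s2 0.
have i3 := sector_integrable lip 0 (M + 1).
have [iG GE] := Rintegral_lebesgue_comb3 (qm - qs) (qs - qp) qp mD i1 i2 i3.
rewrite -/(G _) in iG GE.
(* The slice [t = 0], about which the hypothesis on [F] says nothing, is a null set. *)
rewrite /sector_mass -GE /regular_distr; apply: (proj2 (eq_off_point (p := 0) mD iG _)) => t.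
rewrite /= in_itv/= andbT le_eqVlt => /predU1P[<-//|t0 _].
have t0' := ltW t0.
have j1 := proj1 (slice_integrable lip (s1 * t + 0) t0').
have j2 := proj1 (slice_integrable lip (s2 * t + 0) t0').
have j3 := proj1 (slice_integrable lip (0 * t + (M + 1)) t0').
pose g x := (qm - qs) * (cut (s1 * t + 0) x * phi x t) +
  (qs - qp) * (cut (s2 * t + 0) x * phi x t) + qp * (cut (0 * t + (M + 1)) x * phi x t).
have [jg gE] := Rintegral_lebesgue_comb3 (qm - qs) (qs - qp) qp
  (@measurableT _ R) j1 j2 j3.
rewrite -/(g _) in jg gE.
rewrite -gE.
(* [g'] is an intermediate function: it differs from [g] at most at [s2 * t] and from the fan at
   most at [s1 * t], so each shock costs one exceptional point. *)
pose g' x := if x == s1 * t then g x else F x t * phi x t.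
have [jg' g'E] : leb.-integrable [set: R] (EFin \o g') /\
    \int[leb]_(x in [set: R]) g' x = \int[leb]_(x in [set: R]) g x.
  apply: (eq_off_point (p := s2 * t)) => // x _ /eqP xs2.
  rewrite /g'; case: eqVneq => // xs1.
  have [F1 F2 F3] := FE x t t0.
  have s12t : s1 * t <= s2 * t by rewrite ler_wpM2r.
  rewrite /g /cut !addr0 mul0r add0r.
  have [Mx|xM] := leP (M + 1) x.
    suff -> : phi x t = 0 by ring.
    have [_ _ _ ->//] := lip.
    by rewrite ltr_normr (lt_le_trans _ Mx) ?ltrDl.
  case: (ltgtP x (s1 * t)) xs1 => // xs1 _.
    by rewrite F1// (lt_le_trans xs1)//=; ring.
  case: (ltgtP x (s2 * t)) xs2 => // xs2 _.
    by rewrite F2 ?xs1 ?xs2//=; ring.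
  by rewrite F3//=; ring.
rewrite -g'E.
apply: (proj2 (eq_off_point (p := s1 * t) measurableT jg' _)) => x _ /eqP xs1.
by rewrite /g' (negbTE xs1).
Qed.

Lemma ray_integrable (s : R) :
  leb.-integrable `[0, +oo[ (EFin \o (fun t => t * phi (s * t) t)).
Proof.
have [_ _ lipp supp] := lip.
refine (proj1 (@itv_supported_integral _ `[0, +oo[%classic
  (fun t => t * phi (s * t) t) (M * B) 0 M _ _ _ _ _ _)).
- exact: measurable_itv.
- apply: measurable_funM; first exact: measurable_id.
  apply: (@lipschitz_measurable _ _ _ (L * (`|s| + 1))).
  + exact: measurable_itv.
  + by rewrite mulr_ge0// addr_ge0.
  + move=> x y; rewrite /= !in_itv/= !andbT => x0 y0.
    rewrite (le_trans (lipp _ _ _ _ x0 y0))// -mulrA ler_wpM2l//.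
    by rewrite -mulrBr normrM mulrDl mul1r.
- exact: M0.
- by rewrite /B !mulr_ge0// addr_ge0// mulr_ge0.
- move=> t; rewrite /= in_itv/= andbT => t0.
  have [tM|Mt] := leP t M; last first.
    by rewrite supp ?Mt ?orbT// mulr0 normr0 /B !mulr_ge0// addr_ge0// mulr_ge0.
  by rewrite normrM (ger0_norm t0) ler_pM// (lipschitz_supported_le lip).
- move=> t; rewrite /= in_itv/= andbT => t0 /orP[|Mt]; first by rewrite ltNge t0.
  by rewrite supp ?Mt ?orbT// mulr0.
Qed.

(** At time [t] the sector has width [(b - a) * t], and its points lie within
    [t * (|a - s| + |b - s|)] of the ray. The Lipschitz bound gives an error of order [t ^ 2],
    integrated over [[0, M]]. *)
Lemma sector_mass_taylor (s a b : R) : a <= b ->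
  `|sector_mass phi b 0 - sector_mass phi a 0 - (b - a) * delta_ray s id phi| <=
  L * M ^+ 3 * ((b - a) * (`|a - s| + `|b - s|)).
Proof.
move=> ab; have [_ _ lipp supp] := lip.
have mD : measurable (`[0, +oo[%classic : set R) by exact: measurable_itv.
have ia := sector_integrable lip a 0.
have ib := sector_integrable lip b 0.
have ir := ray_integrable s.
have [iabr iE] := Rintegral_lebesgue_comb3 1 (- 1) (- (b - a)) mD ib ia ir.
have -> : sector_mass phi b 0 - sector_mass phi a 0 - (b - a) * delta_ray s id phi =
    \int[leb]_(t in `[0, +oo[) (1 * slice_mass phi (b * t + 0) t +
      - 1 * slice_mass phi (a * t + 0) t + - (b - a) * (t * phi (s * t) t)).
  by rewrite iE mul1r mulN1r mulNr.
(* Of the three factors [M], two bound [t ^ 2] in the integrand and one is the length of the time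
   interval. *)
rewrite [leRHS](_ : _ = L * M ^+ 2 * ((b - a) * (`|a - s| + `|b - s|)) * (M - 0)); last by ring.
apply: (proj2 (@itv_supported_integral _ `[0, +oo[%classic _ _ 0 M mD _ _ _ _ _)).
- by apply/measurable_EFinP; exact: measurable_int iabr.
- exact: M0.
- by rewrite !mulr_ge0 ?exprn_ge0 ?subr_ge0 ?addr_ge0.
- move=> t; rewrite /= in_itv/= andbT => t0.
  have [tM|Mt] := leP t M; last first.
    rewrite !(slice_mass_out lip)// supp ?Mt ?orbT// !mulr0 !addr0 normr0.
    by rewrite !mulr_ge0 ?exprn_ge0 ?subr_ge0 ?addr_ge0.
  have -> : 1 * slice_mass phi (b * t + 0) t + - 1 * slice_mass phi (a * t + 0) t +
      - (b - a) * (t * phi (s * t) t) =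
    slice_mass phi (b * t + 0) t - slice_mass phi (a * t + 0) t -
      ((b * t + 0) - (a * t + 0)) * phi (s * t) t by ring.
  have abt : a * t + 0 <= b * t + 0 by rewrite !addr0 ler_wpM2r.
  apply: (@le_trans _ _ (L * (t * (`|a - s| + `|b - s|)) * ((b * t + 0) - (a * t + 0)))).
    apply: (slice_mass_taylor lip) => //; first by rewrite !mulr_ge0 ?addr_ge0.
    move=> x; rewrite !addr0 => /andP[ax xb].
    rewrite (le_trans (lipp _ _ _ _ t0 t0))// subrr normr0 addr0 ler_wpM2l//.
    rewrite ler_norml; apply/andP; split.
      have : - `|a - s| * t <= (a - s) * t by apply: ler_wpM2r => //; rewrite lerNl -normrN ler_norm.
      have : 0 <= `|b - s| * t by rewrite mulr_ge0.
      by lra.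
    have : (b - s) * t <= `|b - s| * t by rewrite ler_wpM2r// ler_norm.
    have : 0 <= `|a - s| * t by rewrite mulr_ge0.
    by lra.
  rewrite [leLHS](_ : _ = L * t ^+ 2 * ((b - a) * (`|a - s| + `|b - s|))); last by ring.
  apply: ler_wpM2r; first by rewrite mulr_ge0 ?subr_ge0 ?addr_ge0.
  by rewrite ler_wpM2l// lerXn2r.
- move=> t; rewrite /= in_itv/= andbT => t0 /orP[|Mt]; first by rewrite ltNge t0.
  by rewrite !(slice_mass_out lip)// supp ?Mt ?orbT// !mulr0 !addr0.
Qed.

End Fan.

(** * The intermediate state *)

Section IntermediateState.
Context {R : realType}.
Variables mu k1 k2 rm um rp up rs us : R.
Hypotheses (mu0 : 0 < mu) (k10 : 0 < k1) (k20 : 0 < k2).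
Hypotheses (rm0 : 0 < rm) (rp0 : 0 < rp).
Hypothesis mid : intermediate_state mu k1 k2 rm um rp up rs us.

Lemma shock_g_ge0 (r r' : R) : 0 <= shock_g mu k1 k2 r r'.
Proof. exact: sqrtr_ge0. Qed.

Lemma shock_g_sqr (r r' : R) : 0 < r -> 0 < r' ->
  shock_g mu k1 k2 r r' ^+ 2 =
  (r * r')^-1 * (k1 / (r * r') + k2 ^+ 2 * (r + r') / (2 * mu)).
Proof.
move=> r0 r'0; rewrite sqr_sqrtr// mulr_ge0//.
  by rewrite invr_ge0 mulr_ge0 ?ltW.
by rewrite addr_ge0 ?divr_ge0 ?mulr_ge0 ?addr_ge0 ?exprn_ge0 ?ltW.
Qed.

Lemma intermediate_density_gt : rm < rs /\ rp < rs.
Proof. by case: mid => H _ _; move: H; rewrite gt_max => /andP. Qed.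

Let rm_rs : rm < rs. Proof. by case: intermediate_density_gt. Qed.
Let rp_rs : rp < rs. Proof. by case: intermediate_density_gt. Qed.

Lemma intermediate_density_gt0 : 0 < rs.
Proof. exact: lt_trans rm0 rm_rs. Qed.

Let rs0 := intermediate_density_gt0.

Let rsN : rs != 0. Proof. by rewrite gt_eqF. Qed.

Let drop_left : um - us = shock_g mu k1 k2 rs rm * (rs - rm).
Proof. by case: mid => _ -> _; ring. Qed.

Let drop_right : us - up = shock_g mu k1 k2 rp rs * (rs - rp).
Proof. by case: mid => _ _ ->; ring. Qed.

Lemma intermediate_velocity_between : up <= us <= um.
Proof.
rewrite -subr_ge0 drop_right -[us <= um]subr_ge0 drop_left.
by rewrite !mulr_ge0 ?shock_g_ge0// subr_ge0 ltW.
Qed.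

(** The part of the intermediate pressure that does not vanish in the limit: [k2] tends to 0 but
    [rs] blows up. *)
Let pressure := k2 ^+ 2 / (2 * mu) * rs ^+ 2.

(** Squaring the shock relation and factoring out powers of [rs] leaves coefficients that tend to 1
    with [rm / rs -> 0]. *)
Lemma left_drop_sqr : rm * (um - us) ^+ 2 =
  k1 / rm * (1 - rm / rs) ^+ 2 +
  pressure * ((1 - rm / rs) ^+ 2 * (1 + rm / rs)).
Proof.
have [rmN muN] : rm != 0 /\ mu != 0 by split; rewrite gt_eqF.
rewrite drop_left exprMn shock_g_sqr// /pressure; field.
by rewrite rmN rsN muN.
Qed.

Lemma right_drop_sqr : rp * (us - up) ^+ 2 =
  k1 / rp * (1 - rp / rs) ^+ 2 +
  pressure * ((1 - rp / rs) ^+ 2 * (1 + rp / rs)).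
Proof.
have [rpN muN] : rp != 0 /\ mu != 0 by split; rewrite gt_eqF.
rewrite drop_right exprMn shock_g_sqr// /pressure; field.
by rewrite rpN rsN muN.
Qed.

(** Bounds on the coefficients of the squared drops, for [w = rm / rs] or [rp / rs]. The lower bound
    [1 / 4] later controls [pressure] by the drop. *)
Let cubic_bounds (w : R) : 0 <= w <= 1 ->
  [/\ 0 <= (1 - w) ^+ 2 <= 1, 1 - 2 * w <= (1 - w) ^+ 2 * (1 + w) <= 1 &
      w <= 2^-1 -> 4^-1 <= (1 - w) ^+ 2 * (1 + w)].
Proof. by move=> /andP[w0 w1]; split; [|apply/andP; split|]; nra. Qed.

Let ratio01 (r : R) : 0 < r -> r < rs -> 0 <= r / rs <= 1.
Proof.
by move=> r0 rrs; rewrite divr_ge0 ?(ltW r0) ?(ltW rs0)//= ler_pdivrMr// mul1r ltW.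
Qed.

Let pressure0 : 0 < pressure.
Proof. by rewrite mulr_gt0 ?divr_gt0 ?mulr_gt0 ?exprn_gt0. Qed.

(** With [A], [B] the two drops, [(A + B) ^ 2 <= 2 * (A ^ 2 + B ^ 2)], and each square is at most a
    [k1] term plus a [pressure] term. The smallness of [k1] lets its share be absorbed as half of
    the left-hand side. *)
Lemma pressure_lower_bound :
  4 * (rm ^- 2 + rp ^- 2) * k1 <= (um - up) ^+ 2 ->
  (um - up) ^+ 2 <= 4 * (rm^-1 + rp^-1) * pressure.
Proof.
move=> k1U.
have [/andP[_ m1] /andP[_ m2] _] := cubic_bounds (ratio01 rm0 rm_rs).
have [/andP[_ p1] /andP[_ p2] _] := cubic_bounds (ratio01 rp0 rp_rs).
have Hm : rm * (um - us) ^+ 2 <= k1 / rm + pressure.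
  rewrite left_drop_sqr lerD//; first by rewrite ler_piMr// divr_ge0// ltW.
  by rewrite ler_piMr// ltW.
have Hp : rp * (us - up) ^+ 2 <= k1 / rp + pressure.
  rewrite right_drop_sqr lerD//; first by rewrite ler_piMr// divr_ge0// ltW.
  by rewrite ler_piMr// ltW.
have drop_sqr_le (r x : R) : 0 < r -> r * x <= k1 / r + pressure ->
    x <= r ^- 2 * k1 + r^-1 * pressure.
  move=> r0 H; rewrite -(ler_pM2l r0) (le_trans H)//.
  by rewrite le_eqVlt; apply/orP; left; apply/eqP; field; rewrite gt_eqF.
(* Nonnegativity of [(A - B) ^ 2] is the inequality that bounds [(A + B) ^ 2] by twice the sum of
   squares. *)
have := drop_sqr_le _ _ rm0 Hm; have := drop_sqr_le _ _ rp0 Hp.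
have : 0 <= ((um - us) - (us - up)) ^+ 2 by exact: sqr_ge0.
have UE : um - up = (um - us) + (us - up) by ring.
move: k1U; rewrite UE; move: (um - us) (us - up) => A B.
by rewrite !expr2; lra.
Qed.

(** The two squared drops share the factor [pressure], whose coefficients differ by at most
    [2 * (rm / rs + rp / rs)]. The constant 8 is this 2 times the 4 from
    [pressure <= 4 * (rm * (um - up) ^ 2)]. *)
Lemma drop_difference :
  rm / rs <= 2^-1 ->
  `|rm * (um - us) ^+ 2 - rp * (us - up) ^+ 2| <=
  (rm^-1 + rp^-1) * k1 + 8 * rm * (um - up) ^+ 2 * (rm + rp) * rs^-1.
Proof.
move=> rm2.
have [/andP[m0 m1] /andP[m2 m3] /(_ rm2) m4] := cubic_bounds (ratio01 rm0 rm_rs).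
have [/andP[p0 p1] /andP[p2 p3] _] := cubic_bounds (ratio01 rp0 rp_rs).
have /andP[up_us us_um] := intermediate_velocity_between.
have X4 : pressure <= 4 * (rm * (um - up) ^+ 2).
  have : pressure * 4^-1 <= rm * (um - us) ^+ 2.
    rewrite left_drop_sqr -[leLHS]add0r; apply: lerD; last by rewrite ler_pM2l.
    by rewrite mulr_ge0// divr_ge0// ltW.
  have : rm * (um - us) ^+ 2 <= rm * (um - up) ^+ 2.
    by rewrite ler_pM2l// lerXn2r ?nnegrE; lra.
  lra.
rewrite left_drop_sqr right_drop_sqr.
have -> : 8 * rm * (um - up) ^+ 2 * (rm + rp) * rs^-1 =
  4 * (rm * (um - up) ^+ 2) * (2 * (rm / rs + rp / rs)) by field.
have -> : (rm^-1 + rp^-1) * k1 = k1 / rm + k1 / rp by ring.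
have a0 : 0 <= k1 / rm by rewrite divr_ge0 ?ltW.
have b0 : 0 <= k1 / rp by rewrite divr_ge0 ?ltW.
move: m0 m1 m2 m3 p0 p1 p2 p3 X4 a0 b0 pressure0.
move: (4 * (rm * _)) => V.
move: ((1 - rm / rs) ^+ 2 * _) => P; move: ((1 - rp / rs) ^+ 2 * _) => Q.
move: ((1 - rm / rs) ^+ 2) => m'; move: ((1 - rp / rs) ^+ 2) => p'.
move: (rm / rs) (rp / rs) (k1 / rm) (k1 / rp) pressure => m p a b X.
move=> m0 m1 m2 m3 p0 p1 p2 p3 XV a0 b0 X0.
have PQ : `|P - Q| <= 2 * (m + p) by rewrite ler_norml; apply/andP; split; lra.
have -> : a * m' + X * P - (b * p' + X * Q) = (a * m' - b * p') + X * (P - Q) by ring.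
rewrite (le_trans (ler_normD _ _))// lerD//.
  by rewrite ler_norml; apply/andP; split; nra.
rewrite normrM (gtr0_norm X0) ler_pM// ?ltW//.
Qed.

(* Both momentum drops being balanced forces the 1-shock to carry the share
   [sqrt rp / (sqrt rm + sqrt rp)] of the total velocity drop. *)
Lemma velocity_drop_estimate : up < um ->
  `|(um - us) - Num.sqrt rp * (um - up) / (Num.sqrt rm + Num.sqrt rp)| *
    (Num.sqrt rm * Num.sqrt rp * (um - up)) <=
  `|rm * (um - us) ^+ 2 - rp * (us - up) ^+ 2|.
Proof.
move=> up_um; have /andP[up_us us_um] := intermediate_velocity_between.
have a0 : 0 < Num.sqrt rm by rewrite sqrtr_gt0.
have b0 : 0 < Num.sqrt rp by rewrite sqrtr_gt0.
(* With [a], [b] the square roots, this factors [(aA) ^ 2 - (bB) ^ 2], using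
   [aA - bB = (a + b) * A - b * (A + B)]. *)
have -> : rm * (um - us) ^+ 2 - rp * (us - up) ^+ 2 =
    ((um - us) - Num.sqrt rp * (um - up) / (Num.sqrt rm + Num.sqrt rp)) *
    ((Num.sqrt rm + Num.sqrt rp) *
     (Num.sqrt rm * (um - us) + Num.sqrt rp * (us - up))).
  rewrite -{1}(sqr_sqrtr (ltW rm0)) -{1}(sqr_sqrtr (ltW rp0)).
  move: (Num.sqrt rm) (Num.sqrt rp) a0 b0 => a b a0 b0; field.
  by rewrite gt_eqF// addr_gt0.
move: (Num.sqrt rm) (Num.sqrt rp) a0 b0 => a b a0 b0.
(* The second factor [(a + b) * (aA + bB)] is at least [ab * (A + B)], since the omitted terms are
   nonnegative. *)
rewrite normrM ler_wpM2l// ger0_norm.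
  have : 0 <= um - us by lra.
  have : 0 <= us - up by lra.
  have -> : um - up = (um - us) + (us - up) by ring.
  by move: (um - us) (us - up) => A B A0 B0; nra.
by rewrite mulr_ge0 ?addr_ge0 ?mulr_ge0 ?subr_ge0// ltW.
Qed.

(** Replaces the product of [rs], which blows up, and [shock_g] by quantities that converge. *)
Lemma shock_speed1E :
  shock_speed1 mu k1 k2 rm um rs = um - (um - us) / (1 - rm / rs).
Proof.
rewrite /shock_speed1 drop_left; field.
by rewrite rsN subr_eq0 eq_sym lt_eqF.
Qed.

Lemma shock_speed2E :
  shock_speed2 mu k1 k2 rp rs us = us + rp / rs * (us - up) / (1 - rp / rs).
Proof.
rewrite /shock_speed2 [in RHS]drop_right; field.
by rewrite rsN subr_eq0 eq_sym lt_eqF.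
Qed.

(** Measured from [us], the speeds are [us - rm * g] and [us + rp * g'], with [g], [g'] the values
    of [shock_g] at the two shocks. *)
Lemma shock_speeds_ordered :
  shock_speed1 mu k1 k2 rm um rs <= shock_speed2 mu k1 k2 rp rs us.
Proof.
rewrite /shock_speed1 /shock_speed2.
have -> : um = us + shock_g mu k1 k2 rs rm * (rs - rm) by rewrite -drop_left; ring.
have := mulr_ge0 (ltW rm0) (shock_g_ge0 rs rm).
have := mulr_ge0 (ltW rp0) (shock_g_ge0 rp rs).
lra.
Qed.

(** The sum of the mass Rankine-Hugoniot conditions at the two shocks, in which [rs * us]
    cancels. *)
Lemma intermediate_mass :
  rs * (shock_speed2 mu k1 k2 rp rs us - shock_speed1 mu k1 k2 rm um rs) =
  rp * shock_speed2 mu k1 k2 rp rs us - rm * shock_speed1 mu k1 k2 rm um rs -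
  (rp * up - rm * um).
Proof.
rewrite /shock_speed1 /shock_speed2.
have -> : up = us - shock_g mu k1 k2 rp rs * (rs - rp) by rewrite -drop_right; ring.
have -> : um = us + shock_g mu k1 k2 rs rm * (rs - rm) by rewrite -drop_left; ring.
ring.
Qed.

End IntermediateState.

(** * Limits of the intermediate state and of the shock speeds *)

Section IntermediateLimits.
Context {R : realType} (T : Type) (F : set_system T) {FF : Filter F}.
Variables (mu rm um rp up : R) (k1 k2 rs us : T -> R).
Hypotheses (mu0 : 0 < mu) (rm0 : 0 < rm) (rp0 : 0 < rp) (up_um : up < um).
Hypotheses (k1_cvg : k1 n @[n --> F] --> (0 : R)) (k2_cvg : k2 n @[n --> F] --> (0 : R)).
Hypothesis mid : \forall n \near F, [/\ 0 < k1 n, 0 < k2 n &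
  intermediate_state mu (k1 n) (k2 n) rm um rp up (rs n) (us n)].

Let s := delta_speed rm um rp up.
Let s1 n := shock_speed1 mu (k1 n) (k2 n) rm um (rs n).
Let s2 n := shock_speed2 mu (k1 n) (k2 n) rp (rs n) (us n).
Let U0 : 0 < um - up. Proof. by rewrite subr_gt0. Qed.

(** Solving [pressure_lower_bound] for [rs] gives [rs ^- 2 <= C * k2 ^ 2], which is available once
    [k1] is small. *)
Lemma intermediate_density_inv_cvg : (rs n)^-1 @[n --> F] --> (0 : R).
Proof.
pose C := 2 * (rm^-1 + rp^-1) / (mu * (um - up) ^+ 2).
have C0 : 0 <= C.
  apply: divr_ge0; apply: mulr_ge0 => //; last exact: sqr_ge0.
    by apply: addr_ge0; rewrite invr_ge0 ltW.
  exact: ltW.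
pose d := 4 * (rm ^- 2 + rp ^- 2).
have d0 : 0 < d by rewrite /d mulr_gt0// addr_gt0// invr_gt0 exprn_gt0.
apply: (@squeeze_cvgr _ _ _ _ (cst (0 : R)) (fun n => Num.sqrt C * k2 n)); last 2 first.
- exact: cvg_cst.
- by rewrite -[X in _ --> X](mulr0 (Num.sqrt C)); apply: cvgM => //; exact: cvg_cst.
have k1_small : \forall n \near F, k1 n < (um - up) ^+ 2 / d.
  by apply: (cvgr_lt _ k1_cvg); rewrite divr_gt0// exprn_gt0.
near=> n.
have [k10 k20 midn] : [/\ 0 < k1 n, 0 < k2 n &
  intermediate_state mu (k1 n) (k2 n) rm um rp up (rs n) (us n)] by near: n.
have rs0 := intermediate_density_gt0 rm0 midn.
rewrite /= invr_ge0 (ltW rs0)/=.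
have k1U : 4 * (rm ^- 2 + rp ^- 2) * k1 n <= (um - up) ^+ 2.
  by rewrite mulrC -ler_pdivlMr//; apply: ltW; near: n; exact: k1_small.
have H := pressure_lower_bound mu0 k10 k20 rm0 rp0 midn k1U.
rewrite -ler_sqr ?nnegrE ?invr_ge0 ?mulr_ge0 ?sqrtr_ge0 ?(ltW rs0) ?(ltW k20)//.
rewrite exprMn sqr_sqrtr// /C exprVn -[leLHS]mul1r ler_pdivrMr ?exprn_gt0//.
rewrite [leRHS](_ : _ = 4 * (rm^-1 + rp^-1) *
    (k2 n ^+ 2 / (2 * mu) * rs n ^+ 2) / (um - up) ^+ 2).
  by rewrite ler_pdivlMr ?mul1r// exprn_gt0.
by field; rewrite !gt_eqF.
Unshelve. all: by end_near. Qed.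

Let A0 := Num.sqrt rp * (um - up) / (Num.sqrt rm + Num.sqrt rp).

(** [velocity_drop_estimate] followed by [drop_difference]; [e] is the resulting error, and it is
    linear in [k1] and [1 / rs]. *)
Lemma left_drop_cvg : um - us n @[n --> F] --> A0.
Proof.
pose D := Num.sqrt rm * Num.sqrt rp * (um - up).
have D0 : 0 < D by rewrite /D !mulr_gt0 ?sqrtr_gt0.
pose e n := ((rm^-1 + rp^-1) * k1 n + 8 * rm * (um - up) ^+ 2 * (rm + rp) * (rs n)^-1) / D.
have e_cvg : e n @[n --> F] --> (0 : R).
  have -> : (0 : R) = ((rm^-1 + rp^-1) * 0 + 8 * rm * (um - up) ^+ 2 * (rm + rp) * 0) / D.
    by rewrite !mulr0 addr0 mul0r.
  apply: cvgM; last exact: cvg_cst.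
  apply: cvgD; apply: cvgM => //; try exact: cvg_cst.
  exact: intermediate_density_inv_cvg.
(* This is the condition [rm / rs <= 1 / 2] of [drop_difference]. *)
have rs_large : \forall n \near F, (rs n)^-1 < (2 * rm)^-1.
  by apply: (cvgr_lt _ intermediate_density_inv_cvg); rewrite invr_gt0 mulr_gt0.
apply: (@squeeze_cvgr _ _ _ _ (fun n => A0 - e n) (fun n => A0 + e n)); last 2 first.
- by rewrite -[X in _ --> X](subr0 A0); apply: cvgB => //; exact: cvg_cst.
- by rewrite -[X in _ --> X](addr0 A0); apply: cvgD => //; exact: cvg_cst.
near=> n.
have [k10 k20 midn] : [/\ 0 < k1 n, 0 < k2 n &
  intermediate_state mu (k1 n) (k2 n) rm um rp up (rs n) (us n)] by near: n.
have rs0 := intermediate_density_gt0 rm0 midn.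
suff : `|(um - us n) - A0| <= e n by rewrite ler_norml; lra.
rewrite /e ler_pdivlMr//.
apply: (le_trans (velocity_drop_estimate rm0 rp0 midn up_um)).
apply: (drop_difference mu0 k10 k20 rm0 rp0 midn).
have : (rs n)^-1 <= (2 * rm)^-1 by apply: ltW; near: n.
rewrite invfM -(ler_pM2l rm0) => /le_trans; apply.
by rewrite mulrCA divff ?gt_eqF// mulr1.
Unshelve. all: by end_near. Qed.

Let sE : s = um - A0.
Proof.
rewrite /s /A0 /delta_speed; field.
by rewrite gt_eqF// addr_gt0// sqrtr_gt0.
Qed.

Lemma intermediate_velocity_cvg : us n @[n --> F] --> s.
Proof.
have -> : us = (fun n => um - (um - us n)) by apply/funext => n; ring.
by rewrite sE; apply: cvgB; [exact: cvg_cst|exact: left_drop_cvg].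
Qed.

Let ratio_cvg (r : R) : r / rs n @[n --> F] --> (0 : R).
Proof.
rewrite -[X in _ --> X](mulr0 r); apply: cvgM; first exact: cvg_cst.
exact: intermediate_density_inv_cvg.
Qed.

Let compl_inv_cvg (r : R) : (1 - r / rs n)^-1 @[n --> F] --> (1 : R).
Proof.
rewrite -[X in _ --> X]invr1; apply: cvgV; first exact: oner_neq0.
by rewrite -[X in _ --> X]subr0; apply: cvgB; [exact: cvg_cst|exact: ratio_cvg].
Qed.

Lemma shock_speed1_cvg : s1 n @[n --> F] --> s.
Proof.
have : um - (um - us n) / (1 - rm / rs n) @[n --> F] --> s.
  rewrite sE -[X in _ --> um - X]mulr1; apply: cvgB; first exact: cvg_cst.
  by apply: cvgM; [exact: left_drop_cvg|exact: compl_inv_cvg].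
apply: cvg_trans; apply: near_eq_cvg; near=> n.
have [k10 k20 midn] : [/\ 0 < k1 n, 0 < k2 n &
  intermediate_state mu (k1 n) (k2 n) rm um rp up (rs n) (us n)] by near: n.
by rewrite /s1 (shock_speed1E rm0 midn).
Unshelve. all: by end_near. Qed.

Lemma shock_speed2_cvg : s2 n @[n --> F] --> s.
Proof.
have : us n + rp / rs n * (us n - up) / (1 - rp / rs n) @[n --> F] --> s.
  have -> : s = s + 0 * (s - up) * 1 by rewrite !mul0r addr0.
  apply: cvgD; first exact: intermediate_velocity_cvg.
  apply: cvgM; last exact: compl_inv_cvg.
  apply: cvgM; first exact: ratio_cvg.
  by apply: cvgB; [exact: intermediate_velocity_cvg|exact: cvg_cst].
apply: cvg_trans; apply: near_eq_cvg; near=> n.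
have [k10 k20 midn] : [/\ 0 < k1 n, 0 < k2 n &
  intermediate_state mu (k1 n) (k2 n) rm um rp up (rs n) (us n)] by near: n.
by rewrite /s2 (shock_speed2E rm0 midn).
Unshelve. all: by end_near. Qed.

(** The product pairs a factor that blows up with one that vanishes; [intermediate_mass] turns it
    into an expression in the speeds alone. *)
Lemma intermediate_mass_cvg :
  rs n * (s2 n - s1 n) @[n --> F] --> s * jump rm rp - jump (rm * um) (rp * up).
Proof.
have : rp * s2 n - rm * s1 n - (rp * up - rm * um) @[n --> F] -->
    s * jump rm rp - jump (rm * um) (rp * up).
  have -> : s * jump rm rp - jump (rm * um) (rp * up) =
    rp * s - rm * s - (rp * up - rm * um) by rewrite /jump; ring.
  apply: cvgB; last exact: cvg_cst.
  apply: cvgB; apply: cvgM; try exact: cvg_cst.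
    exact: shock_speed2_cvg.
  exact: shock_speed1_cvg.
apply: cvg_trans; apply: near_eq_cvg; near=> n.
have [k10 k20 midn] : [/\ 0 < k1 n, 0 < k2 n &
  intermediate_state mu (k1 n) (k2 n) rm um rp up (rs n) (us n)] by near: n.
by rewrite /s1 /s2 (intermediate_mass midn).
Unshelve. all: by end_near. Qed.

End IntermediateLimits.

(** * Distributional limits *)

Section FanLimit.
Context {R : realType} (phi : R -> R -> R) (L M : R).
Hypothesis lip : lipschitz_supported phi L M.
Context (T : Type) (F : set_system T) {FF : Filter F}.
Variables (s : R) (s1 s2 : T -> R).
Hypotheses (s1_cvg : s1 n @[n --> F] --> s) (s2_cvg : s2 n @[n --> F] --> s).
Hypothesis s12 : \forall n \near F, s1 n <= s2 n.

Let h a := sector_mass phi a 0.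
Let C := L * M ^+ 3.

Let C0 : 0 <= C.
Proof. by case: lip => L0 M0 _ _; rewrite mulr_ge0// exprn_ge0. Qed.

Let dist_cvg (a : T -> R) : a n @[n --> F] --> s -> `|a n - s| @[n --> F] --> (0 : R).
Proof.
move=> ac; rewrite -[X in _ --> X](normr0 R) -(subrr s).
by apply: cvg_norm; apply: cvgB => //; exact: cvg_cst.
Qed.

(** The sector expansion with one end at [s], giving continuity of the sector mass at [s]. *)
Let sector_dist (a : R) :
  `|h a - h s| <= `|a - s| * (`|delta_ray s id phi| + C * `|a - s|).
Proof.
suff H (x y : R) : x <= y -> x = s \/ y = s ->
    `|h y - h x| <= (y - x) * (`|delta_ray s id phi| + C * (y - x)).
  have [as_|/ltW sa] := leP a s.
    rewrite distrC (distrC a) [X in _ <= X * (_ + _ * X)]ger0_norm ?subr_ge0//.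
    by apply: H => //; right.
  by rewrite [X in _ <= X * (_ + _ * X)]ger0_norm ?subr_ge0//; apply: H => //; left.
move=> xy xs; have := sector_mass_taylor lip s xy; rewrite -/C.
have -> : `|x - s| + `|y - s| = y - x.
  rewrite -[in RHS](ger0_norm (x := y - x)) ?subr_ge0//.
  by case: xs => ->; rewrite subrr normr0 ?add0r ?addr0// distrC.
move=> H.
rewrite -(subrK ((y - x) * delta_ray s id phi) (h y - h x)).
rewrite (le_trans (ler_normD _ _))// addrC mulrDr lerD//.
  by rewrite normrM ger0_norm// subr_ge0.
by rewrite (le_trans H)// mulrCA.
Qed.

Lemma sector_mass_cvg (a : T -> R) : a n @[n --> F] --> s ->
  sector_mass phi (a n) 0 @[n --> F] --> sector_mass phi s 0.
Proof.
move=> ac.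
pose e n := `|a n - s| * (`|delta_ray s id phi| + C * `|a n - s|).
have e_cvg : e n @[n --> F] --> (0 : R).
  have -> : (0 : R) = 0 * (`|delta_ray s id phi| + C * 0) by rewrite mul0r.
  apply: cvgM; first exact: dist_cvg.
  apply: cvgD; first exact: cvg_cst.
  by apply: cvgM; [exact: cvg_cst|exact: dist_cvg].
apply: (@squeeze_cvgr _ _ _ _ (fun n => h s - e n) (fun n => h s + e n)); last 2 first.
- by rewrite -[X in _ --> X](subr0 (h s)); apply: cvgB => //; exact: cvg_cst.
- by rewrite -[X in _ --> X](addr0 (h s)); apply: cvgD => //; exact: cvg_cst.
near=> n; have := sector_dist (a n); rewrite -/(e n) -/(h (a n)).
by move: (h (a n)) (h s) (e n) => x y z; rewrite ler_norml; lra.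
Unshelve. all: by end_near. Qed.

(** [q] may be unbounded, but it only enters through [q * (h s2 - h s1)]. The expansion error there
    is the convergent [q * (s2 - s1)] times the vanishing distances to [s]. *)
Lemma fan_cvg (q : T -> R) (qm qp w : R) :
  q n * (s2 n - s1 n) @[n --> F] --> w ->
  (qm - q n) * sector_mass phi (s1 n) 0 + (q n - qp) * sector_mass phi (s2 n) 0 +
    qp * sector_mass phi 0 (M + 1) @[n --> F] -->
  step_plus_delta s qm qp (fun t => w * t) phi.
Proof.
move=> qw.
pose d := delta_ray s id phi.
have dE : delta_ray s (fun t => w * t) phi = w * d.
  rewrite /d /delta_ray -RintegralZl//; last exact: ray_integrable lip s.
  by apply: eq_Rintegral => t _; rewrite mulrA.
(* A step function is a fan with both speeds equal to [s]; the middle sector is empty, and 0 is an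
   arbitrary value for it. *)
have stepE : regular_distr (step_fun s qm qp) phi =
    (qm - 0) * h s + (0 - qp) * h s + qp * sector_mass phi 0 (M + 1).
  apply: (regular_distr_fan lip) => // x t t0; split.
  - by rewrite /step_fun => ->.
  - by move=> /andP[xs sx]; have := lt_trans xs sx; rewrite ltxx.
  - by rewrite /step_fun => sx; rewrite ltNge (ltW sx).
rewrite /step_plus_delta stepE dE.
pose mid n := q n * (h (s2 n) - h (s1 n)).
have mid_cvg : mid n @[n --> F] --> w * d.
  pose e n := `|q n * (s2 n - s1 n)| * C * (`|s1 n - s| + `|s2 n - s|).
  have e_cvg : e n @[n --> F] --> (0 : R).
    have -> : (0 : R) = `|w| * C * (0 + 0) by rewrite addr0 mulr0.
    apply: cvgM; first by apply: cvgM; [exact: cvg_norm|exact: cvg_cst].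
    by apply: cvgD; exact: dist_cvg.
  have main_cvg : q n * (s2 n - s1 n) * d @[n --> F] --> w * d.
    by apply: cvgM => //; exact: cvg_cst.
  apply: (@squeeze_cvgr _ _ _ _ (fun n => q n * (s2 n - s1 n) * d - e n)
    (fun n => q n * (s2 n - s1 n) * d + e n)); last 2 first.
  - by rewrite -[X in _ --> X]subr0; exact: cvgB.
  - by rewrite -[X in _ --> X]addr0; exact: cvgD.
  near=> n.
  have le12 : s1 n <= s2 n by near: n.
  suff : `|mid n - q n * (s2 n - s1 n) * d| <= e n by rewrite ler_norml; lra.
  have -> : mid n - q n * (s2 n - s1 n) * d =
      q n * (h (s2 n) - h (s1 n) - (s2 n - s1 n) * d).
    by rewrite /mid; move: (h _) (h _) (d) => x y z; ring.
  rewrite normrM (le_trans (ler_wpM2l (normr_ge0 _) (sector_mass_taylor lip s le12)))//.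
  rewrite /e normrM (ger0_norm (x := s2 n - s1 n)) ?subr_ge0//.
  by rewrite le_eqVlt; apply/orP; left; apply/eqP; rewrite /C; ring.
have -> : (qm - 0) * h s + (0 - qp) * h s + qp * sector_mass phi 0 (M + 1) + w * d =
    qm * h s + w * d - qp * h s + qp * sector_mass phi 0 (M + 1).
  by move: (h s) (d) (sector_mass _ _ _) => x y z; ring.
have -> : (fun n => (qm - q n) * sector_mass phi (s1 n) 0 +
    (q n - qp) * sector_mass phi (s2 n) 0 + qp * sector_mass phi 0 (M + 1)) =
    (fun n => qm * h (s1 n) + mid n - qp * h (s2 n) + qp * sector_mass phi 0 (M + 1)).
  apply/funext => n; rewrite /mid /h.
  by move: (sector_mass _ _ _) (sector_mass _ _ _) (sector_mass _ _ _) => x y z; ring.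
apply: cvgD; last exact: cvg_cst.
apply: cvgB; last by apply: cvgM; [exact: cvg_cst|exact: sector_mass_cvg].
apply: cvgD => //.
by apply: cvgM; [exact: cvg_cst|exact: sector_mass_cvg].
Unshelve. all: by end_near. Qed.

End FanLimit.

(** * Entropy and Rankine-Hugoniot conditions for the delta shock speed *)

Section DeltaShock.
Context {R : realType}.
Variables rm um rp up : R.
Hypotheses (rm0 : 0 < rm) (rp0 : 0 < rp) (up_um : up < um).

Let s := delta_speed rm um rp up.

(** The speed is a mean of [um] and [up] with positive weights. *)
Lemma delta_speed_between : up < s < um.
Proof.
have a0 : 0 < Num.sqrt rm by rewrite sqrtr_gt0.
have b0 : 0 < Num.sqrt rp by rewrite sqrtr_gt0.
rewrite /s /delta_speed ltr_pdivlMr ?ltr_pdivrMr ?addr_gt0//.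
move: (Num.sqrt rm) (Num.sqrt rp) a0 b0 => a b a0 b0.
have U0 : 0 < um - up by rewrite subr_gt0.
have := mulr_gt0 a0 U0; have := mulr_gt0 b0 U0.
by move=> ? ?; apply/andP; split; lra.
Qed.

(** By the definition of the speed, [sqrt rp * (s - up) = - sqrt rm * (s - um)]. Squaring gives
    [rp * (s - up) ^ 2 = rm * (s - um) ^ 2], which expands to the claim. It makes the momentum
    weight [s] times the mass weight. *)
Lemma delta_speed_momentum :
  s * (s * jump rm rp - jump (rm * um) (rp * up)) =
  s * jump (rm * um) (rp * up) - jump (rm * um ^+ 2) (rp * up ^+ 2).
Proof.
have a0 : 0 < Num.sqrt rm by rewrite sqrtr_gt0.
have b0 : 0 < Num.sqrt rp by rewrite sqrtr_gt0.
have : s * (Num.sqrt rm + Num.sqrt rp) = Num.sqrt rm * um + Num.sqrt rp * up.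
  by rewrite /s /delta_speed divfK// gt_eqF// addr_gt0.
rewrite /jump -(sqr_sqrtr (ltW rm0)) -(sqr_sqrtr (ltW rp0)).
rewrite !sqrtr_sqr !ger0_norm ?sqrtr_ge0//.
move: s (Num.sqrt rm) (Num.sqrt rp) => v a b E.
have /eqP : b * (v - up) + a * (v - um) = v * (a + b) - (a * um + b * up) by ring.
rewrite E subrr addr_eq0 => /eqP bE.
apply/eqP; rewrite -subr_eq0; apply/eqP.
transitivity ((b * (v - up)) ^+ 2 - (a * (v - um)) ^+ 2); first by ring.
by rewrite bE sqrrN subrr.
Qed.

End DeltaShock.

Lemma derive_half_line_linear (R : realType) (c t : R) :
  derive_half_line (fun x => c * x) t c.
Proof.
apply/cvgrPdist_lt => e e0; rewrite near_withinE; near=> x => _.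
rewrite -mulrBr mulfK ?subrr ?normr0// subr_eq0.
near: x; exact: nbhs_dnbhs_neq.
Unshelve. all: by end_near. Qed.

(** * The limit of vanishing [k1], [k2] *)

Section VanishingPressure.
Context {R : realType}.
Notation F := (within [set k : R * R | 0 < k.1 /\ 0 < k.2] (nbhs ((0, 0) : R * R))).

Lemma vanishing_cvg1 : k.1 @[k --> F] --> (0 : R).
Proof. by apply: cvg_within_filter; exact: cvg_fst. Qed.

Lemma vanishing_cvg2 : k.2 @[k --> F] --> (0 : R).
Proof. by apply: cvg_within_filter; exact: cvg_snd. Qed.

(** For fixed densities [shock_g] tends to 0, so the condition reduces in the limit to [up < um].
    Hence the two-shock solution exists for all small parameters, by the hypothesis of the
    theorem. *)
Lemma near_region_IV (mu rm um rp up : R) : 0 < rp -> up < um ->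
  \forall k \near F, region_IV mu k.1 k.2 rm um (rp, up).
Proof.
move=> rp0 up_um.
have g_cvg : shock_g mu k.1 k.2 rp rm * `|rp - rm| @[k --> F] --> (0 : R).
  rewrite -[X in _ --> X](mul0r `|rp - rm|); apply: cvgM; last exact: cvg_cst.
  have g0 : Num.sqrt ((rp * rm)^-1 *
      (0 / (rp * rm) + 0 * 0 * (rp + rm) / (2 * mu))) = 0.
    by rewrite !mul0r addr0 mulr0 sqrtr0.
  rewrite -[X in _ --> X]g0.
  apply: continuous_cvg; first exact: sqrt_continuous.
  apply: cvgM; first exact: cvg_cst.
  apply: cvgD; first by apply: cvgM; [exact: vanishing_cvg1|exact: cvg_cst].
  apply: cvgM; last exact: cvg_cst.
  apply: cvgM; last exact: cvg_cst.
  under eq_fun do rewrite expr2.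
  by apply: cvgM; exact: vanishing_cvg2.
near=> k; split => //=.
rewrite ltrBrDr -ltrBrDl.
near: k; apply: (cvgr_lt _ g_cvg).
by rewrite subr_gt0.
Unshelve. all: by end_near. Qed.

End VanishingPressure.

Theorem theorem2 (R : realType) (mu rm um rp up : R)
    (mu_gt0 : 0 < mu) (rm_gt0 : 0 < rm) (rp_gt0 : 0 < rp) (up_lt_um : up < um)
    (rho u : R -> R -> R -> R)
    (rho_u_sol : forall k1 k2 : R, 0 < k1 -> 0 < k2 ->
       region_IV mu k1 k2 rm um (rp, up) ->
       two_shock_solution mu k1 k2 rm um rp up (rho k1 k2) (u k1 k2)) :
  let s := delta_speed rm um rp up in
  let Rho := step_plus_delta s rm rp
    (fun t => (s * jump rm rp - jump (rm * um) (rp * up)) * t) in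
  let U := regular_distr (step_fun s um up) in
  let M := step_plus_delta s (rm * um) (rp * up)
    (fun t => (s * jump (rm * um) (rp * up)
               - jump (rm * um ^+ 2) (rp * up ^+ 2)) * t) in
  [/\ distr_cvg (fun k1 k2 =>
        regular_distr (fun x t => rho k1 k2 (x / t))) Rho,
      distr_cvg (fun k1 k2 =>
        regular_distr (fun x t => u k1 k2 (x / t))) U,
      distr_cvg (fun k1 k2 =>
        regular_distr (fun x t => rho k1 k2 (x / t) * u k1 k2 (x / t))) M &
      delta_shock_wave_solution rm um rp up s Rho U M].

Proof.
move=> s Rho U M.
pose F := within [set k : R * R | 0 < k.1 /\ 0 < k.2] (nbhs ((0, 0) : R * R)).
pose s1 (k p : R * R) := shock_speed1 mu k.1 k.2 rm um p.1.
pose s2 (k p : R * R) := shock_speed2 mu k.1 k.2 rp p.1 p.2.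
pose ok (k p : R * R) := [/\ 0 < k.1, 0 < k.2,
  intermediate_state mu k.1 k.2 rm um rp up p.1 p.2 &
  forall xi,
    [/\ xi < s1 k p -> rho k.1 k.2 xi = rm /\ u k.1 k.2 xi = um,
        s1 k p < xi < s2 k p -> rho k.1 k.2 xi = p.1 /\ u k.1 k.2 xi = p.2 &
        s2 k p < xi -> rho k.1 k.2 xi = rp /\ u k.1 k.2 xi = up]].
(* One intermediate state is selected for each parameter pair; the default [(0, 0)] is used only
   where the Riemann solution is not provided. *)
have [st Hst] : exists st : R * R -> R * R, \forall k \near F, ok k (st k).
  have /choice[st stP] (k : R * R) : exists p : R * R,
      0 < k.1 -> 0 < k.2 -> region_IV mu k.1 k.2 rm um (rp, up) -> ok k p.
    have [[k10 [k20 kIV]]|H] :=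
        pselect (0 < k.1 /\ 0 < k.2 /\ region_IV mu k.1 k.2 rm um (rp, up)).
      have [rs [us [mid fan]]] := rho_u_sol k.1 k.2 k10 k20 kIV.
      by exists (rs, us).
    by exists (0, 0) => k10 k20 kIV; case: H.
  exists st; near=> k.
  have [k10 k20] : 0 < k.1 /\ 0 < k.2.
    by near: k; rewrite near_withinE; near=> k.
  apply: stP => //; near: k; exact: near_region_IV.
have mid : \forall k \near F, [/\ 0 < k.1, 0 < k.2 &
    intermediate_state mu k.1 k.2 rm um rp up (st k).1 (st k).2].
  by apply: filterS Hst => k [].
have k1_cvg := @vanishing_cvg1 R; have k2_cvg := @vanishing_cvg2 R.
have s1_cvg : s1 k (st k) @[k --> F] --> s.
  exact: (shock_speed1_cvg mu_gt0 rm_gt0 rp_gt0 up_lt_um k1_cvg k2_cvg mid).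
have s2_cvg : s2 k (st k) @[k --> F] --> s.
  exact: (shock_speed2_cvg mu_gt0 rm_gt0 rp_gt0 up_lt_um k1_cvg k2_cvg mid).
have us_cvg : (st k).2 @[k --> F] --> s.
  exact: (intermediate_velocity_cvg mu_gt0 rm_gt0 rp_gt0 up_lt_um k1_cvg k2_cvg mid).
have mass_cvg : (st k).1 * (s2 k (st k) - s1 k (st k)) @[k --> F] -->
    s * jump rm rp - jump (rm * um) (rp * up).
  exact: (intermediate_mass_cvg mu_gt0 rm_gt0 rp_gt0 up_lt_um k1_cvg k2_cvg mid).
have s12 : \forall k \near F, s1 k (st k) <= s2 k (st k).
  by apply: filterS mid => k [k10 k20 midk]; exact: shock_speeds_ordered midk.
(* Density, velocity and momentum are the cases [q r v = r], [v] and [r * v] of one statement. *)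
have limit (q : R -> R -> R) (w : R) :
    q (st k).1 (st k).2 * (s2 k (st k) - s1 k (st k)) @[k --> F] --> w ->
    distr_cvg (fun k1 k2 => regular_distr
      (fun x t => q (rho k1 k2 (x / t)) (u k1 k2 (x / t))))
      (step_plus_delta s (q rm um) (q rp up) (fun t => w * t)).
  move=> qw phi /test_function_lipschitz[L [N lip]].
  have fan_lim := fan_cvg (qm := q rm um) (qp := q rp up) lip s1_cvg s2_cvg s12 qw.
  apply: (cvg_trans _ (fan_lim _)); apply: near_eq_cvg; near=> k.
  have [k10 k20 midk fan] : ok k (st k) by near: k.
  apply/esym/(regular_distr_fan lip); first by near: k.
  move=> x t t0; have [f1 f2 f3] := fan (x / t).
  split=> xt.
  - by have [|-> ->] := f1; rewrite ?ltr_pdivrMr.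
  - by have [|-> ->] := f2; rewrite ?ltr_pdivrMr ?ltr_pdivlMr.
  - by have [|-> ->] := f3; rewrite ?ltr_pdivlMr.
have ds_cvg : s2 k (st k) - s1 k (st k) @[k --> F] --> (0 : R).
  by rewrite -[X in _ --> X](subrr s); exact: cvgB.
have delta0 phi : delta_ray s (fun t => 0 * t) phi = 0.
  rewrite /delta_ray; under eq_Rintegral do rewrite !mul0r.
  by rewrite Rintegral_cst ?mul0r.
have s_mom := delta_speed_momentum um up rm_gt0 rp_gt0.
rewrite -/s in s_mom.
split.
- exact: (limit (fun r v => r) _ mass_cvg).
(* The intermediate velocity stays bounded while the fan closes, so the velocity carries no delta
   measure. *)
- have v_cvg : (st k).2 * (s2 k (st k) - s1 k (st k)) @[k --> F] --> s * 0.
    exact: cvgM.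
  have := limit (fun r v => v) _ v_cvg; rewrite mulr0.
  rewrite /U (_ : step_plus_delta _ _ _ _ = regular_distr (step_fun s um up))//.
  by apply/funext => phi; rewrite /step_plus_delta delta0 addr0.
(* The momentum weight is the limit [s] of [us] times the limiting mass weight. *)
- rewrite /M -s_mom; apply: (limit (fun r v => r * v)).
  have : (st k).2 * ((st k).1 * (s2 k (st k) - s1 k (st k))) @[k --> F] -->
      s * (s * jump rm rp - jump (rm * um) (rp * up)) by exact: cvgM.
  by under eq_fun do rewrite mulrA (mulrC _ (st _).1).
- exists (fun t => (s * jump rm rp - jump (rm * um) (rp * up)) * t); split.
  + split; last by rewrite mulr0.
    exists (fun=> s * jump rm rp - jump (rm * um) (rp * up)); split.
      by move=> t _; exact: derive_half_line_linear.
    by apply: continuous_subspaceT => t; exact: cvg_cst.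
  + move=> t _; split; first exact: derive_half_line_linear.
    rewrite -s_mom; under eq_fun do rewrite mulrC mulrA.
    exact: derive_half_line_linear.
  + exact: delta_speed_between.
  + move=> phi /test_function_lipschitz[L [N lip]]; split => //.
      (* The two velocities differ only on the ray; both are fans with coinciding speeds, so they
         have the same pairing. *)
      rewrite /U !(regular_distr_fan lip (lexx s) (qm := um) (qs := 0) (qp := up))//.
        move=> x t t0; split; rewrite /delta_shock_velocity.
        - by move=> ->.
        - by move=> /andP[xs sx]; have := lt_trans xs sx; rewrite ltxx.
        - by move=> sx; rewrite ltNge (ltW sx) /= gt_eqF.
      move=> x t t0; split; rewrite /step_fun.
      - by move=> ->.
      - by move=> /andP[xs sx]; have := lt_trans xs sx; rewrite ltxx.
      - by move=> sx; rewrite ltNge (ltW sx).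
    rewrite /M -s_mom; congr step_plus_delta.
    by apply/funext => t; rewrite mulrA.
Unshelve. all: by end_near. Qed.
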